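(* Let $n\ge 3$, let $H\subset\mathbb{P}^n_{\mathbb{C}}$ be a fixed hyperplane and let $Q\subset H$ be a given smooth quadric. Given $2n-2$ quadrics in $\mathbb{P}^n_{\mathbb{C}}$ whose intersection with $H$ is $Q$, but which are otherwise general, there are at most $3\cdot 2^{n-1}$ isolated lines in $\mathbb{P}^n_{\mathbb{C}}$ tangent to each of the quadrics. That is, if $V$ denotes the space of all quadrics $X\subset\mathbb{P}^n_{\mathbb{C}}$ with $X\cap H=Q$, there is a nonempty Zariski-open subset $U\subset V^{2n-2}$ such that for every $(X_1,\dots,X_{2n-2})\in U$ the number of isolated common tangent lines to $X_1,\dots,X_{2n-2}$ is at most $3\cdot 2^{n-1}$.
   Context: A quadric in $\mathbb{P}^n_{\mathbb{C}}$ is a hypersurface given by a nonzero quadratic form in $n+1$ variables. Choosing coordinates $x_0,\dots,x_n$ with $H=\{x_0=0\}$ and $Q=\{x_0=0,\ q(x_1,\dots,x_n)=0\}$ with $q$ a nondegenerate quadratic form, the space $V$ of quadrics $X$ with $X\cap H=Q$ consists of the quadrics with equation $q(x_1,\dots,x_n)+x_0\,\ell(x_0,\dots,x_n)=0$, where $\ell$ is an arbitrary linear form; thus $V\cong\mathbb{C}^{n+1}$, with its Zariski topology. A line in $\mathbb{P}^n_{\mathbb{C}}$ is tangent to a quadric if the restriction of the defining quadratic form to the line has vanishing discriminant, i.e. has a double root or vanishes identically. The set of common tangent lines of a collection of quadrics is a closed subset of the Grassmannian of lines in $\mathbb{P}^n_{\mathbb{C}}$; a common tangent line is isolated if it is an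 isolated point of this set. *)

(* Defs.v *)
From mathcomp Require Import all_boot all_order all_algebra.
From mathcomp Require Import classical_sets.
From mathcomp Require Import mpoly.
Set Implicit Arguments.
Unset Strict Implicit.
Unset Printing Implicit Defensive.
Import GRing.Theory.
Local Open Scope ring_scope.
Local Open Scope classical_set_scope.

(* Points of P^n are the one-dimensional subspaces of K^(n+1) = 'rV[K]_n.+1, *)
(* lines are the two-dimensional ones, hyperplanes the n-dimensional ones.   *)
(* A quadratic form is given by its symmetric matrix A, as u |-> u A u^T.    *)

Section Zariski.
Variables (K : fieldType) (I : finType).

(* Value at the point x of K^I of a polynomial in variables indexed by I. *)
Definition peval (p : {mpoly K[#|I|]}) (x : I -> K) : K :=
  p.@[fun k => x (enum_val k)].

(* U is a relatively open subset of Z for the Zariski topology of K^I, the *)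
(* elements of T being identified with points of K^I through coord.        *)
Definition zariski_open_in (T : Type) (coord : T -> I -> K) (Z U : set T) :=
  exists S : set {mpoly K[#|I|]},
    U = [set x | Z x /\ exists2 p, S p & peval p (coord x) != 0].

End Zariski.

Section Quadrics.
Variables (K : fieldType) (n : nat).
Implicit Types (A q : 'M[K]_n.+1) (H L : {vspace 'rV[K]_n.+1}).
Implicit Types (u v : 'rV[K]_n.+1).

Definition polar_form A u v : K := (u *m A *m v^T) 0 0.

Definition quad_form A u : K := polar_form A u u.

Definition nondegenerate_on H A :=
  forall u, u \in H -> (forall v, v \in H -> polar_form A u v = 0) -> u = 0.

(* The quadrics X with X :&: H = {q = 0}, q being nondegenerate on H.  Such  *)
(* an X has an equation restricting on H to a nonzero multiple of q, hence a *)
(* unique one restricting to q itself, by which it is represented.  When     *)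
(* H = {x_0 = 0}, these are the forms q(x_1,..,x_n) + x_0 l(x_0,..,x_n) with *)
(* l linear.                                                                 *)
Definition quadrics_cutting H q : set 'M[K]_n.+1 :=
  [set A | A^T = A /\ forall u, u \in H -> quad_form A u = quad_form q u].

(* All the matrix entries of a k-tuple of quadratic forms. *)
Definition tuple_coord (k : nat) (X : 'I_k -> 'M[K]_n.+1)
    (i : 'I_k * ('I_n.+1 * 'I_n.+1)) : K :=
  X i.1 i.2.1 i.2.2.

(* The discriminant of the binary form quad_form A (s *: u + t *: v). *)
Definition line_disc A u v : K :=
  (polar_form A u v *+ 2) ^+ 2 - 4%:R * quad_form A u * quad_form A v.

Definition tangent A L :=
  forall u v, basis_of L [:: u; v] -> line_disc A u v = 0.

Definition common_tangents (k : nat) (X : 'I_k -> 'M[K]_n.+1) :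
    set {vspace 'rV[K]_n.+1} :=
  [set L | (\dim L = 2)%N /\ forall i, tangent (X i) L].

(* The full antisymmetric array of Pluecker coordinates of the line spanned *)
(* by u and v; it depends on the choice of u and v only up to a scalar.     *)
Definition pluecker u v (ij : 'I_n.+1 * 'I_n.+1) : K :=
  u 0 ij.1 * v 0 ij.2 - u 0 ij.2 * v 0 ij.1.

Definition pluecker_vanish (p : {mpoly K[#|{: 'I_n.+1 * 'I_n.+1}|]}) L :=
  forall u v, basis_of L [:: u; v] -> peval p (pluecker u v) = 0.

(* The Zariski topology of the Grassmannian of lines, induced by its Pluecker *)
(* embedding in projective space.                                             *)
Definition grass_open (O : set {vspace 'rV[K]_n.+1}) :=
  exists2 S : set {mpoly K[#|{: 'I_n.+1 * 'I_n.+1}|]},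
    (forall p, S p -> exists d, p \is d.-homog) &
    O = [set L | (\dim L = 2)%N /\ exists2 p, S p & ~ pluecker_vanish p L].

Definition isolated_in (T : set {vspace 'rV[K]_n.+1}) :
    set {vspace 'rV[K]_n.+1} :=
  [set L | exists2 O, grass_open O & O `&` T = [set L]].

End Quadrics.

(* Main.v *)
Require Import Defs.
From HB Require Import structures.
From mathcomp Require Import all_boot all_order all_algebra.
From mathcomp Require Import classical_sets functions cardinality reals complex.
From mathcomp Require Import mpoly.
From mathcomp Require boolp.
From mathcomp Require Import ring zify.
Set Implicit Arguments.
Unset Strict Implicit.
Unset Printing Implicit Defensive.
Import Order.TTheory GRing.Theory Num.Theory.
Local Open Scope ring_scope.

(** In a basis where H is x_0 = 0 and q is v.v, a quadric of the family is given
    by a vector b and a scalar c, and the line through the point v of H and the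
    affine point p is tangent to it iff
      (b.v + v.p)^2 = v.v (p.p + 2 b.p + c).
    If v.v = 0, then b.v + v.p = 0 for all the quadrics, which forces v = 0 once
    n + 1 of the vectors (1, 2 b) are independent. Hence v.v <> 0 and p may be
    taken orthogonal to v; with w = (v.v) p and z = (v.v)(p.p), tangency becomes
      (b.v)^2 - c v.v = z + 2 b.w,
    which is linear in (z, w) (tangent_line_moment). Solving n + 1 of these
    equations makes z and w quadratic forms in v. What remains are n - 3
    quadratic equations in v, the cubic w.v = 0 and the quartic w.w = (v.v) z,
    with 3 2^(n-1) as product of the degrees. Since v determines p, the common
    tangents not contained in H inject into the common zeros of these forms.

    For the zeros the theorem of Bezout is not needed, because the quadrics are
    general. Put D = 3 2^(n-1). Any D + 1 distinct points of projective space
    impose independent conditions on forms of degree D (points_independent), so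
    if all the forms of degree D are combinations of D monomials and of
    multiples of the given forms, then these have at most D common zeros
    (macaulay_zeros). That condition is the non-vanishing of a minor, which is
    polynomial in the quadrics (open_row_full); thus it defines an open set, and
    one configuration satisfying it suffices. One is chosen for which the
    leading monomials are pure powers of distinct variables, with exponents
    4, 3, 2, ..., 2 (special_form_lead): division with remainder then leaves
    exactly D monomials (macaulay_mx_full, card_standard_type).

    A common tangent contained in H is tangent to Q. It moves in an explicit
    polynomial family of lines of H tangent to Q, all of which are common
    tangents, and is therefore not isolated
    (tangent_line_in_hyperplane_not_isolated). *)

(** * Forms of a given degree as row vectors *)

Section Forms.
Variables (n d : nat).

Definition exponents : {set 'X_{1..n < d.+1}} := [set m : 'X_{1..n < d.+1} | mdeg m == d].

Definition exponent (k : 'I_#|exponents|) : 'X_{1..n} :=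
  (enum_val k : 'X_{1..n < d.+1}).

Lemma mdeg_exponent k : mdeg (exponent k) = d.
Proof. by have := enum_valP k; rewrite inE => /eqP. Qed.

Lemma exponent_inj : injective exponent.
Proof. by move=> k l /val_inj /enum_val_inj. Qed.

Definition form_coefs (R : nzRingType) (h : {mpoly R[n]}) :
    'rV[R]_#|exponents| :=
  \row_k h@_(exponent k).

Definition monomial_values (R : comNzRingType) N (v : 'I_N -> 'I_n -> R) :
    'M[R]_(#|exponents|, N) :=
  \matrix_(k, l) \prod_i v l i ^+ exponent k i.

Lemma form_coefsZD (R : nzRingType) (a : R) (g h : {mpoly R[n]}) :
  form_coefs (a *: g + h) = a *: form_coefs g + form_coefs h.
Proof. by apply/rowP=> k; rewrite !mxE mcoeffD mcoeffZ. Qed.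

Lemma form_coefs0 (R : nzRingType) : form_coefs (0 : {mpoly R[n]}) = 0.
Proof. by apply/rowP=> k; rewrite !mxE mcoeff0. Qed.

Lemma form_coefs_sum (R : nzRingType) I (r : seq I) (P : pred I)
    (h : I -> {mpoly R[n]}) :
  form_coefs (\sum_(i <- r | P i) h i) = \sum_(i <- r | P i) form_coefs (h i).
Proof.
apply: (big_morph _ _ (form_coefs0 R)) => g g'.
by rewrite -[g]scale1r form_coefsZD !scale1r.
Qed.

Lemma form_coefs_other_degree (R : nzRingType) e (h : {mpoly R[n]}) :
  h \is e.-homog -> e != d -> form_coefs h = 0.
Proof.
move=> hh ed; apply/rowP=> k; rewrite !mxE; apply: (dhomog_nemf_coeff hh).
by rewrite /= mdeg_exponent eq_sym.
Qed.

Lemma meval_form (R : comNzRingType) N (v : 'I_N -> 'I_n -> R)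
    (h : {mpoly R[n]}) (l : 'I_N) :
  h \is d.-homog -> (form_coefs h *m monomial_values v) 0 l = h.@[v l].
Proof.
move=> hh; rewrite !mxE.
have hs : (msize h <= d.+1)%N.
  rewrite msizeE; elim: (msupp h) (dhomog_mf hh) => [|m s IH] hm.
    by rewrite big_nil.
  rewrite big_cons geq_max IH ?andbT => [|m' m's]; last first.
    by apply: hm; rewrite inE m's orbT.
  by have /= -> := hm m (mem_head _ _).
rewrite [in RHS](mpolywE hs) raddf_sum /=.
rewrite (bigID (fun m : 'X_{1..n < d.+1} => m \in exponents)) /=.
rewrite [X in _ = _ + X]big1 ?addr0 => [|m]; last first.
  rewrite inE => md; rewrite (dhomog_nemf_coeff hh md) scale0r.
  by rewrite raddf0.
rewrite (big_enum_val (fun m : 'X_{1..n < d.+1} => (h@_m *: 'X_[m]).@[v l])) /=.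
apply: eq_bigr => k _.
by rewrite !mxE mevalZ mevalX.
Qed.

End Forms.

(** For every k, a product of d linear forms, each vanishing at one of the other
    points but not at the k-th, separates the k-th point from the others. *)
Lemma points_independent (K : fieldType) n d (v : 'I_d.+1 -> 'I_n -> K) :
  (forall k l, k != l -> exists a b, v l a * v k b != v l b * v k a) ->
  \rank (monomial_values d v) = d.+1.
Proof.
move=> hv; apply/eqP; rewrite -[_ == _]/(row_full (monomial_values d v)).
rewrite -sub1mx; apply/row_subP => k; rewrite row1.
(* v l a x_b - v l b x_a vanishes at v l, and at v k only if it is proportional. *)
pose g (l : 'I_d.+1) : {mpoly K[n]} := if l == k then 1 else
  if [pick ab : 'I_n * 'I_n | v l ab.1 * v k ab.2 != v l ab.2 * v k ab.1]
  is Some ab then v l ab.1 *: 'X_(ab.2) - v l ab.2 *: 'X_(ab.1) else 0.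
have gE l : l != k -> [/\ g l \is 1.-homog, (g l).@[v l] = 0 & (g l).@[v k] != 0].
  move=> lk; rewrite /g (negbTE lk); case: pickP => [[a b] /= ab|abs]; last first.
    have [|a [b ab]] := hv k l; first by rewrite eq_sym.
    by have := abs (a, b); rewrite /= ab.
  split.
  - by rewrite rpredB ?dhomogZ ?dhomogX /= ?mdeg1.
  - by rewrite mevalB !mevalZ !mevalXU mulrC subrr.
  - by rewrite mevalB !mevalZ !mevalXU subr_eq0.
pose h := \prod_(l | l != k) g l.
have hh : h \is d.-homog.
  have: forall s : seq 'I_d.+1, \prod_(l <- s | l != k) g l \is
     (count (fun l => l != k) s).-homog.
    elim=> [|l s IH]; first by rewrite big_nil dhomog1.
    rewrite big_cons /=; case: ifP => // lk; rewrite dhomogM //.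
    by have [] := gE l lk.
  move/(_ (index_enum 'I_d.+1)); suff -> :
    count (fun l => l != k) (index_enum 'I_d.+1) = d by [].
  have := cardC (pred1 k); rewrite card1 card_ord add1n => -[dE].
  by rewrite -[RHS]dE -sum1_card -sum1_count; apply: eq_bigl.
have hk : h.@[v k] != 0.
  rewrite rmorph_prod /=; apply/prodf_neq0 => l lk.
  by have [_ _] := gE l lk.
have -> : delta_mx 0 k = (h.@[v k])^-1 *: (form_coefs d h *m monomial_values d v).
  apply/rowP=> l; rewrite mxE [RHS]mxE meval_form // eqxx /=.
  have [->|lk] := eqVneq l k; first by rewrite mulVf.
  have [_ gl _] := gE l lk.
  suff -> : h.@[v l] = 0 by rewrite mulr0.
  by rewrite /h (bigD1 l) //= mevalM gl mul0r.
by rewrite scalemx_sub // submxMl.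
Qed.

(** Evaluation at d+1 points is onto, so it sends a family spanning the forms
    of degree d to a family of rank d+1. *)
Lemma points_le_nonvanishing_rows (K : fieldType) n d r
    (A : 'M[K]_(r, #|exponents n d|)) (v : 'I_d.+1 -> 'I_n -> K) (B : {set 'I_r}) :
  (forall k l, k != l -> exists a b, v l a * v k b != v l b * v k a) ->
  row_full A -> (forall i, i \notin B -> row i A *m monomial_values d v = 0) ->
  (d < #|B|)%N.
Proof.
move=> hv Afull hB; rewrite -[d.+1](points_independent hv).
rewrite -(eqmxMfull _ Afull).
have sub : (A *m monomial_values d v <=
            rowsub (enum_val : 'I_#|B| -> _) (A *m monomial_values d v))%MS.
  apply/row_subP => i; have [iB|iB] := boolP (i \in B); last first.
    by rewrite row_mul hB // sub0mx.
  set M := rowsub _ _; have -> : row i (A *m monomial_values d v) =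
    row (enum_rank_in iB i) M by rewrite row_rowsub enum_rankK_in.
  exact: row_sub.
exact: leq_trans (mxrankS sub) (rank_leq_row _).
Qed.

(** * Forms whose leading monomials are pure powers *)

Section Macaulay.
Variables (n d : nat) (J S : finType) (y : J -> 'I_n) (e : J -> nat).
Variable standard : S -> 'X_{1..n}.

(** Multiples of wrong degree are harmless, as their rows below are zero. *)
Definition macaulay_form (R : comNzRingType) (F : J -> {mpoly R[n]})
    (x : S + J * 'X_{1..n < d.+1}) : {mpoly R[n]} :=
  match x with
  | inl s => 'X_[standard s]
  | inr (j, m) => 'X_[m] * F j
  end.

Definition macaulay_mx (R : comNzRingType) (F : J -> {mpoly R[n]}) :
    'M[R]_(#|{: S + J * 'X_{1..n < d.+1}}|, #|exponents n d|) :=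
  \matrix_(k, t) form_coefs d (macaulay_form F (enum_val k)) 0 t.

Lemma row_macaulay_mx (R : comNzRingType) (F : J -> {mpoly R[n]}) k :
  row k (macaulay_mx F) = form_coefs d (macaulay_form F (enum_val k)).
Proof. by apply/rowP=> t; rewrite !mxE. Qed.

Lemma map_macaulay_mx (R R' : comNzRingType) (f : {rmorphism R -> R'})
    (F : J -> {mpoly R[n]}) :
  map_mx f (macaulay_mx F) = macaulay_mx (fun j => map_mpoly f (F j)).
Proof.
apply/matrixP=> k t; rewrite !mxE.
rewrite -mcoeff_map_mpoly; congr (_@_ _).
by case: (enum_val k) => [s|[j m]] /=; rewrite ?rmorphM /= map_mpolyX.
Qed.

(** Division with remainder: a monomial which is not standard is a multiple of
    some leading monomial, hence congruent to smaller monomials modulo the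
    forms F j, and the order on monomials is well founded. *)
Lemma macaulay_mx_full (K : fieldType) (F : J -> {mpoly K[n]}) :
    (forall j, F j \is (e j).-homog) -> (forall j, F j != 0) ->
    (forall j, mlead (F j) = (U_(y j) *+ e j)%MM) ->
    (forall m : 'X_{1..n}, mdeg m = d -> (forall j, m (y j) < e j)%N ->
       exists s, standard s = m) ->
  row_full (macaulay_mx F).
Proof.
move=> Fh F0 Flead hS.
have in_rows x : (form_coefs d (macaulay_form F x) <= macaulay_mx F)%MS.
  by rewrite -[x]enum_rankK -row_macaulay_mx row_sub.
suff mon m : mdeg m = d -> (form_coefs d ('X_[m] : {mpoly K[n]}) <= macaulay_mx F)%MS.
  rewrite -sub1mx; apply/row_subP => k; rewrite row1.
  have -> : delta_mx 0 k = form_coefs d ('X_[exponent k] : {mpoly K[n]}).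
    apply/rowP=> t; rewrite !mxE mcoeffX /= eq_sym.
    by rewrite (inj_eq (@exponent_inj _ _)).
  exact/mon/mdeg_exponent.
elim/(well_founded_ind (@ltom_wf n)): m => m IH md.
case: (boolP [forall j, m (y j) < e j]%N) => [/forallP std|].
  by have [s <-] := hS m md std; exact: in_rows (inl s).
rewrite negb_forall => /existsP [j]; rewrite -leqNgt => jm.
(* The leading monomial E of F j divides x^m. *)
set E := (U_(y j) *+ e j)%MM.
have Em : (E <= m)%MM.
  apply/mnm_lepP => i; rewrite mulmnE mnm1E.
  by case: eqP => [<-|_]; rewrite ?mul1n ?mul0n.
set m' := (m - E)%MM.
have mE : m = (m' + E)%MM by rewrite submK.
have degE : mdeg E = e j by rewrite mdegMn mdeg1 mul1n.
have m'd : (mdeg m' < d.+1)%N by rewrite ltnS -md mE mdegD leq_addr.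
pose c := mleadc (F j); have c0 : c != 0 by rewrite mleadc_eq0.
pose g : {mpoly K[n]} := 'X_[m'] * F j.
have gm : g@_m = c by rewrite /g mulrC mE mcoeffMX /c Flead.
have g_low k : k \in msupp g -> k != m -> (k < m)%O.
  rewrite /g mulrC => /msuppM_le /allpairsP [[k1 k2] /= [k1F]].
  rewrite msuppX inE => /eqP -> -> /=.
  move=> km; rewrite lt_neqAle km /= mE addmC lemc_add2r /E -Flead.
  exact: msupp_le_mlead.
have gh : g \is d.-homog.
  by rewrite -md mE mdegD degE dhomogM // dhomogX.
have -> : 'X_[m] = c^-1 *: g +
    \sum_(k <- msupp g | k != m) (- (c^-1 * g@_k)) *: ('X_[k] : {mpoly K[n]}).
  rewrite {1}[g]mpolyE (bigD1_seq m) ?msupp_uniq ?mcoeff_msupp ?gm //=.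
  rewrite scalerDr scaler_sumr scalerA mulVf // scale1r -addrA -big_split /= big1 ?addr0 // => k _.
  by rewrite scalerA -scalerDl subrr scale0r.
rewrite form_coefsZD form_coefs_sum addmx_sub //.
  by rewrite scalemx_sub //; exact: (in_rows (inr (j, BMultinom m'd))).
rewrite big_seq_cond summx_sub // => k /andP[kg km].
rewrite -[X in form_coefs _ X]addr0 form_coefsZD form_coefs0 addr0 scalemx_sub //.
by apply: IH; [exact: g_low | exact: (dhomog_mf gh)].
Qed.

(** A substitute for the theorem of Bezout. Multiples of the F j vanish at the
    common zeros, where only the standard monomials survive. *)
Lemma macaulay_zeros (K : fieldType) (F : J -> {mpoly K[n]})
    (v : 'I_d.+1 -> 'I_n -> K) :
  (forall j, F j \is (e j).-homog) -> row_full (macaulay_mx F) ->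
  (forall k j, (F j).@[v k] = 0) ->
  (forall k l, k != l -> exists a b, v l a * v k b != v l b * v k a) ->
  (d < #|S|)%N.
Proof.
move=> Fh Ffull vF hv.
pose B := [set k : 'I_#|{: S + J * 'X_{1..n < d.+1}}| |
            if enum_val k is inl _ then true else false].
have cardB : #|B| = #|S|.
  have -> : B = [set enum_rank (inl s : S + J * 'X_{1..n < d.+1}) | s : S].
    apply/setP=> k; rewrite inE; apply/idP/imsetP => [|[s _ ->]]; last first.
      by rewrite enum_rankK.
    case E: (enum_val k) => [s|//] _; exists s => //.
    by rewrite -E enum_valK.
  by rewrite card_imset // => s t /enum_rank_inj [].
rewrite -cardB; apply: (points_le_nonvanishing_rows hv Ffull) => k.
rewrite inE row_macaulay_mx; case: (enum_val k) => [//|[j m]] /= _.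
have hh : 'X_[m] * F j \is (mdeg m + e j).-homog by rewrite dhomogM // dhomogX.
have [md|md] := eqVneq (mdeg m + e j)%N d; last first.
  by rewrite (form_coefs_other_degree hh md) mul0mx.
rewrite md in hh; apply/rowP => l; rewrite meval_form //.
by rewrite mevalM vF mulr0 mxE.
Qed.

End Macaulay.

(** * The elimination of the moment of a line *)

Definition dot (S : comNzRingType) n (x y : 'rV[S]_n) : S :=
  \sum_j x 0 j * y 0 j.

Section DotTheory.
Variables (S : comNzRingType) (n : nat).
Implicit Types x y z : 'rV[S]_n.

Lemma dotC x y : dot x y = dot y x.
Proof. by apply: eq_bigr => j _; rewrite mulrC. Qed.

Lemma dotDl x y z : dot (x + y) z = dot x z + dot y z.
Proof. by rewrite -big_split; apply: eq_bigr => j _; rewrite !mxE mulrDl. Qed.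

Lemma dotZl a x z : dot (a *: x) z = a * dot x z.
Proof. by rewrite mulr_sumr; apply: eq_bigr => j _; rewrite !mxE mulrA. Qed.

Lemma dotDr x y z : dot z (x + y) = dot z x + dot z y.
Proof. by rewrite dotC dotDl !(dotC z). Qed.

Lemma dotZr a x z : dot z (a *: x) = a * dot z x.
Proof. by rewrite dotC dotZl dotC. Qed.

Lemma dot_delta j z : dot (delta_mx 0 j) z = z 0 j.
Proof.
rewrite /dot (bigD1 j) //= mxE !eqxx mul1r big1 ?addr0 // => i ij.
by rewrite mxE (negbTE ij) andbF mul0r.
Qed.

Lemma dot0l z : dot 0 z = 0.
Proof. by rewrite /dot big1 // => j _; rewrite mxE mul0r. Qed.

Lemma map_dot (S' : comNzRingType) (f : {rmorphism S -> S'}) x y :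
  f (dot x y) = dot (map_mx f x) (map_mx f y).
Proof. by rewrite rmorph_sum; apply: eq_bigr => j _; rewrite rmorphM !mxE. Qed.

End DotTheory.

Section Eliminant.
Variable m : nat.
Let n := m.+3.

(** The first n + 1 quadrics are used to solve for the moment of the line, and
    the n - 3 remaining ones give equations. *)
Let I := 'I_(n.+1 + m).

Section Def.
Variables (S : comNzRingType) (b : I -> 'rV[S]_n) (c : I -> S) (x : 'rV[S]_n).

(** Tangency is linear in z = (v.v)(p.p) and in the moment w = (v.v) p of the
    line: (b_i.v)^2 - c_i v.v = z + 2 b_i.w. This is the matrix of the first
    n + 1 equations. *)
Definition moment_mx : 'M[S]_(1 + n) :=
  \matrix_i row_mx 1%:M (b (lshift m i) *+ 2).

Definition tangency_form (i : I) : S := dot (b i) x ^+ 2 - c i * dot x x.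

(** The solution (z, w) times the determinant of the system: Cramer's rule
    without denominators keeps everything polynomial in b and c. *)
Definition scaled_moment : 'cV[S]_(1 + n) :=
  \adj moment_mx *m \col_i tangency_form (lshift m i).

(** What v has to satisfy once (z, w) is eliminated, in this order: the quartic
    w.w = (v.v) z, the cubic w.v = 0 and the n - 3 remaining tangency
    conditions. The coefficient ring is arbitrary, so that the same definition
    gives the polynomials in v, their values at a point, and their versions
    with indeterminate b and c. *)
Definition eliminant (j : option (option 'I_m)) : S :=
  let z := usubmx scaled_moment 0 0 in
  let w := (dsubmx scaled_moment)^T in
  match j with
  | None => dot w w - \det moment_mx * dot x x * z
  | Some None => dot w x
  | Some (Some k) => \det moment_mx * tangency_form (rshift _ k)
                     - z - dot (b (rshift _ k)) w *+ 2
  end.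

Lemma mul_moment_mx (z : S) (w : 'rV[S]_n) i :
  (moment_mx *m col_mx z%:M w^T) i 0 = z + dot (b (lshift m i)) w *+ 2.
Proof.
have -> : (moment_mx *m col_mx z%:M w^T) i 0 =
          (row i moment_mx *m col_mx z%:M w^T) 0 0 by rewrite -row_mul [RHS]mxE.
rewrite rowK mul_row_col mul1mx !mxE eqxx mulr1n; congr (_ + _).
by rewrite -sumrMnl; apply: eq_bigr => j _; rewrite mulmxnE mxE mulrnAl.
Qed.

(** By Cramer's rule, any solution (z, w) of the linear system computes the
    eliminants, even over a ring where the determinant is not invertible. *)
Lemma eliminantE (z : S) (w : 'rV[S]_n) :
    (forall i, tangency_form (lshift m i) = z + dot (b (lshift m i)) w *+ 2) ->
  let D := \det moment_mx in
  forall j, eliminant j = match j with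
    | None => D ^+ 2 * (dot w w - dot x x * z)
    | Some None => D * dot w x
    | Some (Some k) => D * (tangency_form (rshift _ k)
                            - z - dot (b (rshift _ k)) w *+ 2)
    end.
Proof.
move=> hzw D.
have sE : scaled_moment = D *: col_mx z%:M w^T.
  rewrite /scaled_moment -mul_scalar_mx -mul_adj_mx -mulmxA; congr (_ *m _).
  by apply/colP=> i; rewrite mxE hzw mul_moment_mx.
have zE : usubmx scaled_moment 0 0 = D * z.
  by rewrite sE scale_col_mx col_mxKu !mxE eqxx mulr1n.
have wE : (dsubmx scaled_moment)^T = D *: w.
  by rewrite sE scale_col_mx col_mxKd linearZ /= trmxK.
case=> [[k|]|] /=; rewrite ?zE wE ?dotZl ?dotZr -/D; ring.
Qed.

End Def.

Lemma eq_eliminant (S : comNzRingType) (b b' : I -> 'rV[S]_n) (c c' : I -> S) x j :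
  b =1 b' -> c =1 c' -> eliminant b c x j = eliminant b' c' x j.
Proof. by move=> /boolp.funext -> /boolp.funext ->. Qed.

Lemma map_moment_mx (S S' : comNzRingType) (f : {rmorphism S -> S'}) b :
  map_mx f (moment_mx b) = moment_mx (fun i => map_mx f (b i)).
Proof.
apply/row_matrixP => i; rewrite -map_row !rowK map_row_mx map_mx1; congr row_mx.
by apply/rowP => j; rewrite mxE !mulmxnE mxE rmorphMn.
Qed.

Lemma map_tangency_form (S S' : comNzRingType) (f : {rmorphism S -> S'}) b c x i :
  f (tangency_form b c x i) =
  tangency_form (fun i => map_mx f (b i)) (f \o c) (map_mx f x) i.
Proof. by rewrite rmorphB rmorphXn rmorphM /= !map_dot. Qed.

Lemma map_eliminant (S S' : comNzRingType) (f : {rmorphism S -> S'}) b c x j :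
  f (eliminant b c x j) =
  eliminant (fun i => map_mx f (b i)) (f \o c) (map_mx f x) j.
Proof.
have sE : map_mx f (scaled_moment b c x) =
    scaled_moment (fun i => map_mx f (b i)) (f \o c) (map_mx f x).
  rewrite map_mxM map_mx_adj map_moment_mx; congr (_ *m _).
  by apply/colP=> i; rewrite !mxE map_tangency_form.
have zE : f (usubmx (scaled_moment b c x) 0 0) =
    usubmx (scaled_moment (fun i => map_mx f (b i)) (f \o c) (map_mx f x)) 0 0.
  by rewrite -sE -map_usubmx [RHS]mxE.
have wE : map_mx f (dsubmx (scaled_moment b c x))^T =
    (dsubmx (scaled_moment (fun i => map_mx f (b i)) (f \o c) (map_mx f x)))^T.
  by rewrite -map_trmx map_dsubmx sE.
have dE : f (\det (moment_mx b)) = \det (moment_mx (fun i => map_mx f (b i))).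
  by rewrite -det_map_mx map_moment_mx.
case: j => [[k|]|] /=;
  rewrite ?rmorphB ?rmorphMn ?rmorphM /= ?map_dot ?map_tangency_form ?zE ?wE ?dE //.
Qed.

End Eliminant.

Section EliminantForms.
Variable m : nat.
Let n := m.+3.
Let I := 'I_(n.+1 + m).

Definition degree (j : option (option 'I_m)) : nat :=
  match j with None => 4 | Some None => 3 | Some (Some _) => 2 end.

Definition generic_point (R : comNzRingType) : 'rV[{mpoly R[n]}]_n := \row_j 'X_j.

Definition eliminant_form (R : comNzRingType) (b : I -> 'rV[R]_n) (c : I -> R)
    (j : option (option 'I_m)) : {mpoly R[n]} :=
  eliminant (fun i => map_mx (@mpolyC n R) (b i)) (@mpolyC n R \o c)
    (generic_point R) j.

Lemma map_eliminant_form (R R' : comNzRingType) (f : {rmorphism R -> R'}) b c j :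
  map_mpoly f (eliminant_form b c j) =
  eliminant_form (fun i => map_mx f (b i)) (f \o c) j.
Proof.
rewrite /eliminant_form map_eliminant.
have -> : map_mx (map_mpoly f) (generic_point R) = generic_point R'.
  by apply/rowP => k; rewrite !mxE map_mpolyX.
apply: eq_eliminant => i /=; last exact: map_mpolyC.
by apply/rowP => k; rewrite !mxE /= map_mpolyC.
Qed.

Lemma meval_eliminant_form (R : comNzRingType) b c j (v : 'rV[R]_n) :
  (eliminant_form b c j).@[v 0] = eliminant b c v j.
Proof.
rewrite /eliminant_form map_eliminant.
have -> : map_mx (meval (v 0)) (generic_point R) = v.
  by apply/rowP => k; rewrite !mxE mevalXU.
apply: eq_eliminant => i /=; last exact: mevalC.
by apply/rowP => k; rewrite !mxE /= mevalC.
Qed.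

Lemma dot_homog (R : comNzRingType) d e k (x y : 'rV[{mpoly R[k]}]_k) :
  (forall j, x 0 j \is d.-homog) -> (forall j, y 0 j \is e.-homog) ->
  dot x y \is (d + e).-homog.
Proof. by move=> hx hy; apply: rpred_sum => j _; apply: dhomogM. Qed.

Lemma eliminant_form_homog (R : comNzRingType) b c j :
  @eliminant_form R b c j \is (degree j).-homog.
Proof.
rewrite /eliminant_form.
set b' := fun i : I => _; set c' := _ \o c; set X := generic_point R.
have Xh k : X 0 k \is 1.-homog by rewrite mxE dhomogX /= mdeg1.
have Ch (a : R) d h : h \is d.-homog -> a%:MP * h \is [in R[n], d.-homog].
  by move=> hh; rewrite mul_mpolyC rpredZ.
have bh i : dot (b' i) X \is 1.-homog.
  by apply: rpred_sum => k _; rewrite mxE Ch.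
have XXh : dot X X \is 2.-homog by exact: (@dot_homog _ 1 1).
have gh i : tangency_form b' c' X i \is 2.-homog.
  by rewrite rpredB ?Ch // (@dhomogMn _ _ _ 1 _ 2).
have Mb' : moment_mx b' = map_mx (@mpolyC n R) (moment_mx b) by rewrite map_moment_mx.
have sh i : scaled_moment b' c' X i 0 \is 2.-homog.
  rewrite /scaled_moment Mb' -map_mx_adj mxE.
  by apply: rpred_sum => k _; rewrite mxE [X in _ * X]mxE Ch.
have wh k : (dsubmx (scaled_moment b' c' X))^T 0 k \is 2.-homog by rewrite mxE mxE; exact: sh.
have zh : usubmx (scaled_moment b' c' X) 0 0 \is 2.-homog by rewrite mxE; exact: sh.
case: j => [[k|]|]; rewrite /eliminant ?Mb' ?det_map_mx -?mulrA.
- rewrite !rpredB ?Ch // rpredMn // /dot rpred_sum // => l _.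
  by rewrite [X in X * _]mxE Ch.
- exact: (@dot_homog _ 2 1).
- by rewrite rpredB ?Ch ?(@dhomogM _ _ _ 2 _ 2) // (@dot_homog _ 2 2).
Qed.

End EliminantForms.

(** * A special configuration *)

(** Every monomial of degree e other than x_i^e involves another variable. *)
Lemma meval_coordinate_point (R : comNzRingType) k e (h : {mpoly R[k]}) (i : 'I_k) :
  h \is e.-homog -> h.@[(delta_mx 0 i : 'rV_k) 0] = h@_(U_(i) *+ e).
Proof.
move=> hh; rewrite mevalE [in RHS](mpolyE h) raddf_sum /= big_seq [RHS]big_seq.
apply: eq_bigr => M Mh; rewrite mcoeffZ mcoeffX; congr (_ * _).
have Md : mdeg M = e by apply: (dhomog_mf hh).
rewrite (bigD1 i) //= mxE !eqxx expr1n mul1r; case: eqP => [->|ME].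
  rewrite big1 // => l li; rewrite mulmnE mnm1E; rewrite eq_sym in li; rewrite (negbTE li) mul0n.
  by rewrite expr0.
have [l li Ml] : exists2 l, l != i & M l != 0%N.
  apply/exists_inP; rewrite -negb_forall_in; apply/negP => /forall_inP M0; apply: ME.
  have M0' l : l != i -> M l = 0%N by move=> /M0 /eqP.
  apply/mnmP => l; rewrite mulmnE mnm1E -Md mdegE (bigD1 i) //= big1 => [|a /M0' //].
  rewrite addn0; case: eqP => [->|il]; first by rewrite mul1n.
  by rewrite mul0n M0' //; apply/eqP => li; rewrite li in il.
by rewrite (bigD1 l) //= mxE (negbTE li) andbF expr0n (negbTE Ml) mul0r.
Qed.

(** Among the monomials of degree e not involving the variables before x_i, the
    largest is x_i^e. *)
Lemma mlead_pure_power (R : comNzRingType) k e (h : {mpoly R[k]}) (i : 'I_k) :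
    h \is e.-homog -> h@_(U_(i) *+ e) != 0 ->
    (forall M (l : 'I_k), M \in msupp h -> (l < i)%N -> M l = 0%N) ->
  mlead h = (U_(i) *+ e)%MM.
Proof.
move=> hh he h0; have h_n0 : h != 0.
  by apply: contraNneq he => ->; rewrite mcoeff0.
apply/le_anti/andP; split; last by apply: msupp_le_mlead; rewrite mcoeff_msupp.
have Mh := mlead_supp h_n0; set M := mlead h in Mh *.
have Md : mdeg M = e by apply: (dhomog_mf hh).
have [->//|ME] := eqVneq M (U_(i) *+ e)%MM.
apply/ltW/ltmcP; first by rewrite Md mdegMn mdeg1 mul1n.
exists i => [l li|]; rewrite mulmnE mnm1E; last first.
  rewrite eqxx mul1n ltnNge; apply: contra ME => eM; apply/eqP/mnmP => l.
  rewrite mulmnE mnm1E.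
  have Mi : M i = e by apply/eqP; rewrite eqn_leq eM -Md mdegE (bigD1 i) //= leq_addr.
  case: eqP => [<-|/eqP il]; first by rewrite mul1n.
  move: Md; rewrite mdegE (bigD1 i) //= Mi (bigD1 l) 1?eq_sym //=.
  by move=> /eqP; rewrite -{2}[e]addn0 eqn_add2l addn_eq0 mul0n => /andP[/eqP].
have il : (i == l) = false by apply/eqP => E; rewrite E ltnn in li.
by rewrite il mul0n (h0 M).
Qed.

(** The exponent of the first variable is a second grading; degree 0 for it
    means that the first variable does not occur. *)
Definition first_exponent k (M : 'X_{1..k.+1}) : nat := M ord0.

Lemma first_exponent0 k : first_exponent (0%MM : 'X_{1..k.+1}) = 0%N.
Proof. by rewrite /first_exponent mnmE. Qed.

Lemma first_exponentD k :
  {morph @first_exponent k : M N / (M + N)%MM >-> (M + N)%N}.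
Proof. by move=> M N; rewrite /first_exponent mnmDE. Qed.

HB.instance Definition _ k :=
  isMeasure.Build k.+1 (@first_exponent k) (@first_exponent0 k) (@first_exponentD k).

(** The values of b and c are found backwards, from the solution they should
    give. With t, u the first two variables and s = v.v, the solution z = 0,
      w = (2 t u, u^2 + t^2 - 3 s, x_2^2, x_3^2, ...)
    is obtained from b = 0, b = 2 (u -+ t) with c = 12, and b = 2 x_l. In the
    cubic w.v the terms in u t^2 cancel, so that t disappears and u^3 leads; in
    the quartic w.w, t^4 leads. For the remaining quadrics, b = 4 x_l gives the
    equations x_l^2 = 0. *)

Section Special.
Variable m : nat.
Let n := m.+3.
Let I := 'I_(n.+1 + m).
Let i0 : 'I_n := ord0.
Let i1 : 'I_n := lift ord0 ord0.

Section Def.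
Variable S : comNzRingType.

Definition special_linear (i : I) : 'rV[S]_n :=
  match fintype.split i with
  | inl i' =>
    if unlift ord0 i' is Some l then
      if l == i0 then 2%:R *: delta_mx 0 i1 - 2%:R *: delta_mx 0 i0
      else if l == i1 then 2%:R *: delta_mx 0 i1 + 2%:R *: delta_mx 0 i0
      else 2%:R *: delta_mx 0 l
    else 0
  | inr k => 4%:R *: delta_mx 0 (rshift 3 k)
  end.

Definition special_const (i : I) : S :=
  match fintype.split i with
  | inl i' => if unlift ord0 i' is Some l then if (l < 2)%N then 12%:R else 0 else 0
  | inr k => 0
  end.

(** The solution of the tangency equations, together with z = 0. *)
Definition special_moment (x : 'rV[S]_n) : 'rV[S]_n :=
  \row_l (if l == i0 then 2%:R * x 0 i0 * x 0 i1
          else if l == i1 then x 0 i1 ^+ 2 + x 0 i0 ^+ 2 - 3%:R * dot x x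
          else x 0 l ^+ 2).

Lemma dot_recl (x y : 'rV[S]_n) : dot x y = x 0 i0 * y 0 i0 + x 0 i1 * y 0 i1 +
  \sum_(l < m.+1) x 0 (lift ord0 (lift ord0 l)) * y 0 (lift ord0 (lift ord0 l)).
Proof. by rewrite /dot !big_ord_recl addrA. Qed.

Definition special_eliminant (x : 'rV[S]_n) (j : option (option 'I_m)) : S :=
  let w := special_moment x in
  match j with
  | None => \det (moment_mx special_linear) ^+ 2 * dot w w
  | Some None => \det (moment_mx special_linear) * dot w x
  | Some (Some k) => \det (moment_mx special_linear) * (8%:R * x 0 (rshift 3 k) ^+ 2)
  end.

Lemma eliminant_special x j :
  eliminant special_linear special_const x j = special_eliminant x j.
Proof.
rewrite (@eliminantE _ _ _ _ _ 0 (special_moment x)) => [|i].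
  case: j => [[k|]|] //=; rewrite ?mulr0 ?subr0 //; congr (_ * _).
  rewrite /tangency_form /special_linear /special_const (unsplitK (inr k)).
  rewrite !dotZl !dot_delta mxE /=.
  set a := x 0 _; ring.
rewrite add0r /tangency_form /special_linear /special_const (unsplitK (inl i)).
case: unliftP => [l _|_]; last by rewrite !dot0l; ring.
have [->|l0] := eqVneq l i0.
  rewrite -scaleN1r !(dotDl, dotZl) !dot_delta !mxE /=; ring.
have [->|l1] := eqVneq l i1.
  rewrite !(dotDl, dotZl) !dot_delta !mxE /=; ring.
have -> : (l < 2)%N = false.
  by apply/negbTE; rewrite -leqNgt; move: l0 l1; rewrite -!val_eqE /= /bump /=; lia.
rewrite !dotZl !dot_delta !mxE (negbTE l0) (negbTE l1); ring.
Qed.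

End Def.

Lemma map_special_linear (S S' : comNzRingType) (f : {rmorphism S -> S'}) i :
  map_mx f (special_linear S i) = special_linear S' i.
Proof.
rewrite /special_linear; case: fintype.split => [i'|k]; last first.
  by rewrite map_mxZ map_delta_mx rmorph_nat.
case: unliftP => [l _|_]; last by rewrite map_mx0.
case: ifP => _; first by rewrite map_mxB !map_mxZ !map_delta_mx !rmorph_nat.
case: ifP => _; first by rewrite map_mxD !map_mxZ !map_delta_mx !rmorph_nat.
by rewrite map_mxZ map_delta_mx rmorph_nat.
Qed.

Lemma map_special_const (S S' : comNzRingType) (f : {rmorphism S -> S'}) i :
  f (special_const S i) = special_const S' i.
Proof.
rewrite /special_const; case: fintype.split => [i'|k]; last by rewrite rmorph0.
by case: unliftP => [l _|_]; [case: ifP => _|]; rewrite ?rmorph_nat ?rmorph0.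
Qed.

Section Field.
Variable K : numFieldType.

(** Besides 0, the vectors b of the first n + 1 quadrics form a basis, so that
    the vectors (1, 2 b) are independent. *)
Lemma det_special_moment_mx : \det (moment_mx (special_linear K)) != 0.
Proof.
rewrite -unitfE -det_tr -[_ \is a _]/(_ \in unitmx) -row_free_unit.
rewrite -kermx_eq0; apply/rowV0P => v /sub_kermxP /(congr1 trmx).
rewrite trmx_mul trmx0 trmxK -[v]hsubmxK tr_row_mx.
set z := (lsubmx v) 0 0; set w := rsubmx v.
have -> : (lsubmx v)^T = z%:M by rewrite [lsubmx v]mx11_scalar tr_scalar_mx.
move=> Mv.
have {}Mv i : z + dot (special_linear K (lshift m i)) w *+ 2 = 0.
  by rewrite -mul_moment_mx Mv mxE.
have z0 : z = 0.
  have := Mv ord0; rewrite /special_linear (unsplitK (inl ord0)) unlift_none.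
  by rewrite dot0l mul0rn addr0.
have Mw (l : 'I_n) : dot (special_linear K (lshift m (lift ord0 l))) w = 0.
  have := Mv (lift ord0 l); rewrite z0 add0r => /eqP.
  by rewrite mulrn_eq0 /= => /eqP.
have two0 : (2 : K) != 0 by rewrite pnatr_eq0.
have w01 : w 0 i0 = 0 /\ w 0 i1 = 0.
  have := Mw i0; have := Mw i1.
  rewrite /special_linear (unsplitK (inl (lift ord0 i1))) (unsplitK (inl (lift ord0 i0))).
  rewrite !liftK /= -scaleN1r !(dotDl, dotZl) !dot_delta => h1 h0.
  have e1 : 2 * (2 * w 0 i1) = 0 by rewrite -[RHS]addr0 -{1}h1 -h0; ring.
  have e0 : 2 * (2 * w 0 i0) = 0 by rewrite -[RHS]subr0 -{1}h1 -h0; ring.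
  by split; apply/eqP; [move/eqP: e0 | move/eqP: e1]; rewrite !mulf_eq0 (negbTE two0).
have w0 : w = 0.
  apply/rowP => l; rewrite [RHS]mxE.
  have [->|l0] := eqVneq l i0; first by case: w01.
  have [->|l1] := eqVneq l i1; first by case: w01.
  have := Mw l; rewrite /special_linear (unsplitK (inl (lift ord0 l))) liftK.
  rewrite (negbTE l0) (negbTE l1) dotZl dot_delta => /eqP.
  by rewrite mulf_eq0 (negbTE two0) => /eqP.
by rewrite w0 [lsubmx v]mx11_scalar -/z z0 raddf0 row_mx0.
Qed.

Definition leading_var (j : option (option 'I_m)) : 'I_n :=
  match j with None => i0 | Some None => i1 | Some (Some k) => rshift 3 k end.

Definition special_form (j : option (option 'I_m)) : {mpoly K[n]} :=
  eliminant_form (special_linear K) (special_const K) j.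

Let D := \det (moment_mx (special_linear K)).

Lemma special_formE j : special_form j =
  match j with
  | None => (D ^+ 2) *: dot (special_moment (generic_point m K))
                            (special_moment (generic_point m K))
  | Some None => D *: (- 2%:R *: 'X_i1 ^+ 3 + \sum_(l < m.+1)
      ('X_(lift ord0 (lift ord0 l)) ^+ 3
       - 3%:R *: ('X_i1 * 'X_(lift ord0 (lift ord0 l)) ^+ 2)))
  | Some (Some k) => (8%:R * D) *: 'X_(rshift 3 k) ^+ 2
  end.
Proof.
rewrite /special_form /eliminant_form.
rewrite (@eq_eliminant _ _ _ (special_linear _) _ (special_const _)); first last.
- by move=> i; exact: map_special_const.
- by move=> i; exact: map_special_linear.
rewrite eliminant_special /special_eliminant.
have <- : D%:MP = \det (moment_mx (special_linear {mpoly K[n]})).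
  rewrite -det_map_mx map_moment_mx; congr (\det _).
  by congr moment_mx; apply: boolp.funext => i; rewrite map_special_linear.
case: j => [[k|]|]; last by rewrite -mul_mpolyC rmorphXn.
  by rewrite mxE mulrA -mul_mpolyC rmorphM rmorph_nat [8%:R * _]mulrC.
rewrite mul_mpolyC; congr (_ *: _); rewrite dot_recl.
set g := generic_point m K.
pose X (l : 'I_m.+1) : {mpoly K[n]} := 'X_(lift ord0 (lift ord0 l)).
have gE l : g 0 (lift ord0 (lift ord0 l)) = X l by rewrite mxE.
have g0 : g 0 i0 = 'X_i0 by rewrite mxE.
have g1 : g 0 i1 = 'X_i1 by rewrite mxE.
have qE : dot g g = 'X_i0 ^+ 2 + 'X_i1 ^+ 2 + \sum_l X l ^+ 2.
  rewrite dot_recl g0 g1 -!expr2; congr (_ + _).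
  by apply: eq_bigr => l _; rewrite gE -expr2.
have -> : \sum_(l < m.+1) special_moment g 0 (lift ord0 (lift ord0 l)) *
     g 0 (lift ord0 (lift ord0 l)) = \sum_l X l ^+ 3.
  by apply: eq_bigr => l _; rewrite mxE /= gE -exprSr.
rewrite sumrB -scaler_sumr -mulr_sumr -/(X _) !mxE /= ?g0 ?g1 qE -!mul_mpolyC.
rewrite !(rmorphN, rmorph_nat).
set s3 := \sum_l X l ^+ 3; set s2 := \sum_l X l ^+ 2; ring.
Qed.

(** The leading coefficients are nonzero because the forms do not vanish at the
    corresponding coordinate points. *)
Lemma special_form_lead j :
  mlead (special_form j) = (U_(leading_var j) *+ degree j)%MM
  /\ special_form j != 0.
Proof.
have D0 := det_special_moment_mx; rewrite -/D in D0.
have nz (k : nat) : (k.+1%:R : K) != 0 by rewrite pnatr_eq0.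
suff [h0 h1] : (special_form j)@_(U_(leading_var j) *+ degree j) != 0 /\
    (forall M (l : 'I_n), M \in msupp (special_form j) -> (l < leading_var j)%N -> M l = 0%N).
  split; last by apply: contraNneq h0 => ->; rewrite mcoeff0.
  by apply: mlead_pure_power => //; exact: eliminant_form_homog.
split.
  rewrite -meval_coordinate_point; last exact: eliminant_form_homog.
  rewrite meval_eliminant_form eliminant_special /special_eliminant -/D.
  case: j => [[k|]|] /=; apply: mulf_neq0; rewrite ?expf_neq0 //.
  - by rewrite mxE !eqxx expr1n mulr1.
  - rewrite dotC dot_delta mxE /= dot_delta !mxE /=.
    rewrite (_ : _ - _ = - 2%:R) ?oppr_eq0 //; ring.
  - rewrite dot_recl big1 => [|l _]; last by rewrite !mxE /=; ring.
    rewrite !mxE /= dot_delta mxE /=.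
    rewrite (_ : _ + _ = 4%:R) //; ring.
case: j => [[k|]|] M l; last by [].
  rewrite special_formE => /msuppZ_le.
  rewrite mpolyXn msuppX inE => /eqP -> lk.
  rewrite mulmnE mnm1E; case: eqP => [E|_]; last by rewrite mul0n.
  by rewrite -E ltnn in lk.
move=> MF; rewrite ltnS leqn0 => /eqP l0.
have -> : l = ord0 by apply/val_inj.
suff : special_form (Some None) \is 0.-homog for (@first_exponent m.+2).
  by move=> /dhomog_mf /(_ M MF).
rewrite special_formE rpredZ // rpredD //.
  by rewrite rpredZ // mpolyXn dhomogX /= /first_exponent mulmnE mnm1E.
apply: rpred_sum => a _; rewrite rpredB //.
  by rewrite mpolyXn dhomogX /= /first_exponent mulmnE mnm1E.
by rewrite rpredZ // mpolyXn -mpolyXD dhomogX /= /first_exponent mnmDE mulmnE !mnm1E.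
Qed.

Section Standard.
Variable d : nat.

Definition standard_type := ('I_4 * 'I_3 * {ffun 'I_m -> bool})%type.

Definition standard_low (s : standard_type) : 'X_{1..n} :=
  [multinom match fintype.split (l : 'I_(3 + m)) with
            | inl a => nth 0%N [:: s.1.1 : nat; s.1.2 : nat] a
            | inr k => s.2 k : nat
            end | l < n].

Definition standard (s : standard_type) : 'X_{1..n} :=
  (standard_low s + U_(lshift m (ord_max : 'I_3)) *+ (d - mdeg (standard_low s)))%MM.

Lemma card_standard_type : #|{: standard_type}| = (3 * 2 ^ (n - 1))%N.
Proof.
rewrite !card_prod card_ffun !card_ord card_bool /n subn1 /= !expnS; lia.
Qed.

(** The exponents other than the third are bounded, and the third one is what
    is missing to the degree. *)
Lemma standard_surj (M : 'X_{1..n}) : mdeg M = d ->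
  (forall j, M (leading_var j) < degree j)%N -> exists s, standard s = M.
Proof.
move=> Md Mj; pose f := [ffun k : 'I_m => M (rshift 3 k) == 1%N].
exists (Ordinal (Mj None), Ordinal (Mj (Some None)), f).
set s := (_, _, _).
have sE : M = (standard_low s + U_(lshift m (ord_max : 'I_3)) *+ M (lshift m (ord_max : 'I_3)))%MM.
  apply/mnmP => l; rewrite mnmDE mulmnE mnm1E mnmE.
  case: splitP => [a|k] lE.
    have {lE} -> : l = lshift m a by apply/val_inj.
    rewrite -val_eqE.
    case: a => [[|[|[|//]]] ha] /=; rewrite ?mul0n ?addn0 ?mul1n ?add0n.
    - by congr (M _); apply/val_inj.
    - by congr (M _); apply/val_inj.
    - by congr (M _); apply/val_inj.
  have {lE} -> : l = rshift 3 k by apply/val_inj.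
  rewrite ffunE; have /= := Mj (Some (Some k)).
  rewrite mul0n addn0.
  by case: (M _) => [|[|]].
rewrite /standard; suff -> : (d - mdeg (standard_low s))%N = M (lshift m (ord_max : 'I_3)).
  by rewrite -sE.
by rewrite -Md {1}sE mdegD mdegMn mdeg1 mul1n addKn.
Qed.

Lemma special_macaulay_full :
  row_full (macaulay_mx d standard special_form).
Proof.
apply: (macaulay_mx_full (y := leading_var) (e := @degree m)).
- by move=> j; exact: eliminant_form_homog.
- by move=> j; case: (special_form_lead j).
- by move=> j; case: (special_form_lead j).
- exact: standard_surj.
Qed.

End Standard.
End Field.
End Special.

(** * Genericity *)

(** Full rank is the non-vanishing of a maximal minor, which is a polynomial
    in the parameters. *)
Lemma open_row_full (K : fieldType) N r s (A : 'M[{mpoly K[N]}]_(r, s)) (x0 : 'I_N -> K) :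
  row_full (map_mx (meval x0) A) ->
  exists2 p : {mpoly K[N]}, p.@[x0] != 0 &
    forall x, p.@[x] != 0 -> row_full (map_mx (meval x) A).
Proof.
move=> A0; pose f := fullrankfun A0.
have minorE x : (\det (rowsub f A)).@[x] = \det (rowsub f (map_mx (meval x) A)).
  by rewrite -det_map_mx; congr (\det _); apply/matrixP => i j; rewrite !mxE.
exists (\det (rowsub f A)) => [|x]; rewrite minorE -unitfE.
  by rewrite -[_ \is a _]/(_ \in unitmx) -row_full_unit; exact: fullrowsub_full.
rewrite -[_ \is a _]/(_ \in unitmx) -row_full_unit -!sub1mx => /submx_trans; apply.
by apply/row_subP => i; rewrite row_rowsub row_sub.
Qed.

(** Here b and c are families of polynomials in the coordinates of the parameter
    space, and x0 is a parameter realizing the special configuration. *)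

Section Generic.
Variables (K : numFieldType) (m N d : nat).
Let n := m.+3.
Let I := 'I_(n.+1 + m).
Variables (b : I -> 'rV[{mpoly K[N]}]_n) (c : I -> {mpoly K[N]}) (x0 : 'I_N -> K).

Lemma generic_macaulay_full :
    (forall i, map_mx (meval x0) (b i) = special_linear K i) ->
    (forall i, (c i).@[x0] = special_const K i) ->
  exists2 p : {mpoly K[N]}, p.@[x0] != 0 &
    forall x, p.@[x] != 0 ->
      let bx i := map_mx (meval x) (b i) in let cx i := (c i).@[x] in
      \det (moment_mx bx) != 0 /\
      row_full (macaulay_mx d (@standard m d) (eliminant_form bx cx)).
Proof.
move=> b0 c0; pose A := macaulay_mx d (@standard m d) (eliminant_form b c).
have AE x : map_mx (meval x) A = macaulay_mx d (@standard m d)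
    (eliminant_form (fun i => map_mx (meval x) (b i)) (fun i => (c i).@[x])).
  rewrite map_macaulay_mx; congr macaulay_mx.
  by apply: boolp.funext => j; rewrite map_eliminant_form.
have ME x : (\det (moment_mx b)).@[x] = \det (moment_mx (fun i => map_mx (meval x) (b i))).
  by rewrite -det_map_mx map_moment_mx.
have bE : (fun i => map_mx (meval x0) (b i)) = special_linear K by apply: boolp.funext.
have cE : (fun i => (c i).@[x0]) = special_const K by apply: boolp.funext.
have [|p p0 hp] := @open_row_full _ _ _ _ A x0.
  by rewrite AE bE cE; exact: special_macaulay_full.
exists (p * \det (moment_mx b)) => [|x].
  by rewrite mevalM mulf_neq0 // ME bE det_special_moment_mx.
rewrite mevalM mulf_eq0 negb_or => /andP[px Mx] bx cx; split; first by rewrite -ME.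
by rewrite -AE; exact: hp.
Qed.

End Generic.

(** * Orthonormal frames *)

Section Polar.
Variables (K : fieldType) (n : nat).
Implicit Types (A : 'M[K]_n.+1) (u v w : 'rV[K]_n.+1).

Lemma polar_formDl A u v w : polar_form A (u + v) w = polar_form A u w + polar_form A v w.
Proof. by rewrite /polar_form !mulmxDl mxE. Qed.

Lemma polar_formZl A a u w : polar_form A (a *: u) w = a * polar_form A u w.
Proof. by rewrite /polar_form -!scalemxAl mxE. Qed.

Lemma polar_formDr A u v w : polar_form A w (u + v) = polar_form A w u + polar_form A w v.
Proof. by rewrite /polar_form linearD mulmxDr mxE. Qed.

Lemma polar_formZr A a u w : polar_form A w (a *: u) = a * polar_form A w u.
Proof. by rewrite /polar_form linearZ -scalemxAr mxE. Qed.

Lemma polar_formC A u v : A^T = A -> polar_form A u v = polar_form A v u.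
Proof.
move=> As; rewrite /polar_form -[in RHS](trmxK (v *m A *m u^T)) [RHS]mxE.
by rewrite !trmx_mul trmxK As mulmxA.
Qed.

Definition polar_formE := (polar_formDl, polar_formZl, polar_formDr, polar_formZr).

Lemma polar_formBl A u v w : polar_form A (u - v) w = polar_form A u w - polar_form A v w.
Proof. by rewrite -scaleN1r polar_formDl polar_formZl mulN1r. Qed.

End Polar.

Lemma vspace_row_space (K : fieldType) N (H : {vspace 'rV[K]_N}) :
  {B : 'M[K]_(\dim H, N) | \rank B = \dim H & forall u, (u \in H) = (u <= B)%MS}.
Proof.
pose B := \matrix_(i < \dim H) (vbasis H)`_i.
have rB i : row i B = (vbasis H)`_i by rewrite rowK.
have HB u : (u \in H) = (u <= B)%MS.
  apply/idP/idP => [uH|/submxP [a ->]].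
    rewrite (coord_vbasis uH); apply: summx_sub => i _; apply: scalemx_sub.
    by rewrite -rB row_sub.
  rewrite mulmx_sum_row; apply: memv_suml => i _; apply: memvZ.
  by rewrite rB vbasis_mem // mem_nth ?size_tuple.
exists B => //; apply/eqP; rewrite -[_ == _]/(row_free B).
apply/inj_row_free => a aB; apply/rowP => i; rewrite [RHS]mxE.
have /freeP/(_ (fun i => a 0 i)) := basis_free (vbasisP H); apply.
by apply: etrans aB; rewrite mulmx_sum_row; apply: eq_bigr => k _; rewrite rB.
Qed.

Section Frame.
Variables (K : numClosedFieldType) (n : nat).
Variables (H : {vspace 'rV[K]_n.+1}) (q : 'M[K]_n.+1).
Hypotheses (qs : q^T = q) (qH : nondegenerate_on H q).

(** Gram-Schmidt: a vector of H outside the span of an orthonormal family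
    can be made orthogonal to it, and if it is isotropic, it or its sum with
    a vector not orthogonal to it can be replaced by a non-isotropic one. *)
Lemma orthonormal_family k : (k <= \dim H)%N ->
  exists2 E : 'M[K]_(k, n.+1), (forall u, (u <= E)%MS -> u \in H)
                             & E *m q *m E^T = 1%:M.
Proof.
have [B Bfree HB] := vspace_row_space H.
elim: k => [|k IH] kH.
  exists 0; last by apply/matrixP => -[].
  by move=> u /submxP [a ->]; rewrite mulmx0 mem0v.
have [E EH Eq] := IH (ltnW kH).
pose pr (u : 'rV[K]_n.+1) : 'rV[K]_n.+1 := u - u *m q *m E^T *m E.
have prH u : u \in H -> pr u \in H by move=> uH; apply: memvB => //; apply: EH; exact: submxMl.
have prE u : pr u *m q *m E^T = 0.
  rewrite /pr !mulmxBl -[u *m q *m E^T *m E *m q]mulmxA -[_ *m (E *m q) *m _]mulmxA Eq.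
  by rewrite mulmx1 subrr.
have [x xH [x0 xE]] : exists2 x, x \in H & x != 0 /\ x *m q *m E^T = 0.
  have : ~~ (B <= E)%MS.
    apply: contraL kH => /mxrankS; rewrite Bfree -leqNgt => /leq_trans; apply.
    exact: rank_leq_row.
  move=> /row_subPn [i iE]; exists (pr (row i B)); first by rewrite prH // HB row_sub.
  split; last exact: prE.
  by apply: contra iE; rewrite subr_eq0 => /eqP ->; rewrite submxMl.
have [z zH [z0 zE]] : exists2 z, z \in H & quad_form q z != 0 /\ z *m q *m E^T = 0.
  have [xx|] := eqVneq (quad_form q x) 0; last by exists x.
  have [y0 y0H xy0] : exists2 y, y \in H & polar_form q x y != 0.
    apply: boolp.contrapT => no; move/eqP: x0; apply; apply: qH => // v vH.
    by apply/eqP; apply: boolp.contrapT => /negP xv; apply: no; exists v.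
  pose y := pr y0.
  have xy : polar_form q x y != 0.
    suff -> : polar_form q x y = polar_form q x y0 by [].
    rewrite polar_formC // polar_formBl [X in X - _]polar_formC // -[RHS]subr0.
    have Eqx : E *m q *m x^T = 0.
      by apply: trmx_inj; rewrite !trmx_mul trmxK qs mulmxA xE trmx0.
    congr (_ - _); rewrite /polar_form -[_ *m E *m q]mulmxA -[_ *m (E *m q) *m _]mulmxA.
    by rewrite Eqx mulmx0 mxE.
  have yH : y \in H by exact: prH.
  have yE : y *m q *m E^T = 0 by exact: prE.
  move: y xy yH yE => {y0 y0H xy0} y xy yH yE.
  have [yy|] := eqVneq (quad_form q y) 0; last by exists y.
  exists (x + y); first exact: memvD.
  split; last by rewrite !mulmxDl xE yE addr0.
  rewrite /quad_form !polar_formE -/(quad_form q x) -/(quad_form q y) xx yy.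
  by rewrite add0r addr0 (polar_formC y) // -mulr2n mulrn_eq0.
pose s := sqrtC (quad_form q z).
have s0 : s != 0 by rewrite sqrtC_eq0.
pose z' := s^-1 *: z.
exists (col_mx z' E).
  move=> u /submxP [a ->]; pose a' : 'rV_(1 + k) := a.
  have -> : a *m col_mx z' E = lsubmx a' *m z' + rsubmx a' *m E.
    by rewrite -[RHS]mul_row_col hsubmxK.
  rewrite [lsubmx _]mx11_scalar mul_scalar_mx; apply: memvD.
    by rewrite /z' !memvZ.
  by apply: EH; exact: submxMl.
suff : (col_mx z' E : 'M_(1 + k, n.+1)) *m q *m (col_mx z' E)^T = 1%:M by [].
rewrite mul_col_mx tr_col_mx mul_col_row Eq.
have z'E : z' *m q *m E^T = 0 by rewrite -!scalemxAl zE scaler0.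
rewrite z'E (_ : E *m q *m z'^T = 0); last first.
  by apply: trmx_inj; rewrite !trmx_mul trmxK qs mulmxA z'E trmx0.
rewrite [RHS]scalar_mx_block; congr (block_mx _ _ _ _).
rewrite [LHS]mx11_scalar -[X in X%:M]/(polar_form q z' z') !polar_formE.
rewrite -/(quad_form q z) -[quad_form q z]sqrtCK -/s.
by congr (_%:M); field.
Qed.

Lemma orthonormal_frame : \dim H = n ->
  exists e : 'rV[K]_(1 + n), exists E : 'M[K]_(n, 1 + n),
    [/\ E *m q *m E^T = 1%:M, forall u, (u \in H) = (u <= E)%MS &
        col_mx e E \in unitmx].
Proof.
move=> dH; have [|E EH Eq] := @orthonormal_family n; first by rewrite dH.
have [B Bfree HB] := vspace_row_space H.
have Efree : row_free E.
  by apply/row_freeP; exists (q *m E^T); rewrite mulmxA.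
have HE u : (u \in H) = (u <= E)%MS.
  rewrite HB; suff /eqmxP eqEB : (E == B)%MS by rewrite eqEB.
  have EB : (E <= B)%MS by apply/row_subP => i; rewrite -HB EH // row_sub.
  by rewrite -(geq_leqif (mxrank_leqif_eq EB)) Bfree (eqnP Efree) dH.
have : ~~ ((1%:M : 'M[K]_n.+1) <= E)%MS.
  by rewrite sub1mx /row_full (eqnP Efree) neq_ltn leqnn.
move=> /row_subPn [i iE]; exists (row i 1%:M), E; split=> //.
rewrite -row_free_unit; apply/inj_row_free => a.
rewrite -[a]hsubmxK mul_row_col [lsubmx a]mx11_scalar mul_scalar_mx.
set t := lsubmx a 0 0; set w := rsubmx a => tw.
have [t0|t0] := eqVneq t 0; last first.
  have te : t *: row i 1%:M = - (w *m E) by apply/eqP; rewrite -addr_eq0 tw.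
  have eE : row i 1%:M = t^-1 *: (- (w *m E)) by rewrite -te scalerA mulVf ?scale1r.
  by case/negP: iE; rewrite eE scalemx_sub // -mulNmx submxMl.
move: tw; rewrite t0 scale0r add0r => wE.
have -> : w = 0 by rewrite -[w]mulmx1 -Eq !mulmxA wE !mul0mx.
by rewrite raddf0 row_mx0.
Qed.

End Frame.

(** * Tangent lines not contained in the hyperplane *)

Section Pencils.
Variables (K : fieldType) (V : vectType K).
Implicit Types (L : {vspace V}) (u v x y : V).

Lemma line_basis L : \dim L = 2 -> exists u v, basis_of L [:: u; v].
Proof.
move=> dL; have := vbasisP L; move: (vbasis L); rewrite dL => t.
by case/tupleP: t => u t; case/tupleP: t => v t; rewrite tuple0; exists u, v.
Qed.

Lemma line_basisE L u v x y : basis_of L [:: u; v] ->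
  u \in <<[:: x; y]>>%VS -> v \in <<[:: x; y]>>%VS -> basis_of L [:: x; y].
Proof.
move=> Luv ux vx; rewrite basisEdim; have /andP[_] := Luv.
move=> /eqP /=; rewrite (span_basis Luv) => ->; rewrite leqnn andbT.
by rewrite -(span_basis Luv); apply/span_subvP => z; rewrite !inE => /orP[] /eqP ->.
Qed.

Lemma mem_pencil a b x y : a *: x + b *: y \in <<[:: x; y]>>%VS.
Proof. by rewrite memvD ?memvZ ?memv_span // !inE eqxx ?orbT. Qed.

Lemma pencilP x y u : u \in <<[:: x; y]>>%VS -> exists a b, u = a *: x + b *: y.
Proof.
rewrite span_cons span_seq1 => /memv_addP [w /vlineP [a ->] [w' /vlineP [b ->] ->]].
by exists a, b.
Qed.

End Pencils.

(** By polarization, the quadrics of the family agree on H also as bilinear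
    forms. *)
Lemma polar_form_cutting_in (K : numFieldType) n (H : {vspace 'rV[K]_n.+1}) q X u v :
  q^T = q -> quadrics_cutting H q X -> u \in H -> v \in H ->
  polar_form X u v = polar_form q u v.
Proof.
move=> qs [Xs XH] uH vH.
have pol (A : 'M[K]_n.+1) x y : A^T = A ->
    polar_form A x y *+ 2 = quad_form A (x + y) - quad_form A x - quad_form A y.
  by move=> As; rewrite /quad_form !polar_formE (polar_formC y) //; ring.
have /eqP : polar_form X u v *+ 2 = polar_form q u v *+ 2.
  by rewrite !pol // !XH ?memvD.
by rewrite -subr_eq0 -mulrnBl mulrn_eq0 subr_eq0 => /eqP.
Qed.

Section Frame.
Variables (K : numClosedFieldType) (n : nat).
Variables (H : {vspace 'rV[K]_n.+1}) (q : 'M[K]_n.+1).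
Variables (e : 'rV[K]_(1 + n)) (E : 'M[K]_(n, 1 + n)).
Hypothesis Eq : E *m q *m E^T = 1%:M.
Hypothesis HE : forall u, (u \in H) = (u <= E)%MS.
Hypothesis Pu : col_mx e E \in unitmx.
Hypothesis qs : q^T = q.

(** On v E + a e a quadric X of the family is the form v.v + 2 a b.v + a^2 c, where
    b is its linear part and c its constant part. *)
Definition linear_part (X : 'M[K]_n.+1) : 'rV[K]_n := e *m X *m E^T.
Definition const_part (X : 'M[K]_n.+1) : K := quad_form X e.

Lemma frame_decomposition u : exists a v, u = a *: e + v *m E.
Proof.
exists (lsubmx (u *m invmx (col_mx e E)) 0 0), (rsubmx (u *m invmx (col_mx e E))).
rewrite -mul_scalar_mx -mx11_scalar -mul_row_col hsubmxK.
by rewrite mulmxKV.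
Qed.

Lemma mem_frame v : v *m E \in H.
Proof. by rewrite HE submxMl. Qed.

Lemma polar_form_frame A v w :
  E *m A *m E^T = 1%:M -> polar_form A (v *m E) (w *m E) = dot v w.
Proof.
move=> EA; rewrite /polar_form trmx_mul.
rewrite (_ : v *m E *m A *m (E^T *m w^T) = v *m (E *m A *m E^T) *m w^T).
  by rewrite EA mulmx1 mxE; apply: eq_bigr => i _; rewrite mxE.
by rewrite !mulmxA.
Qed.

Lemma polar_form_cutting X v w : quadrics_cutting H q X ->
  polar_form X (v *m E) (w *m E) = dot v w.
Proof.
by move=> Xq; rewrite (polar_form_cutting_in qs Xq) ?mem_frame // polar_form_frame.
Qed.

Lemma polar_form_linear_part X v : polar_form X e (v *m E) = dot (linear_part X) v.
Proof.
rewrite /polar_form /linear_part trmx_mul mulmxA mxE.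
by apply: eq_bigr => i _; rewrite [v^T i 0]mxE.
Qed.

Lemma line_disc_frame X v p : quadrics_cutting H q X ->
  line_disc X (v *m E) (e + p *m E) =
  4%:R * ((dot (linear_part X) v + dot v p) ^+ 2
          - dot v v * (dot p p + dot (linear_part X) p *+ 2 + const_part X)).
Proof.
move=> Xq; have [Xs _] := Xq; rewrite /line_disc /quad_form !polar_formE.
rewrite !(polar_form_cutting _ _ Xq) !(polar_formC _ e Xs) // !polar_form_linear_part.
rewrite -/(quad_form X e) -/(const_part X); ring.
Qed.

(** The line is spanned by its point at infinity and an affine point. *)
Lemma affine_line_basis L : (\dim L = 2)%N -> ~~ (L <= H)%VS ->
  exists v p, basis_of L [:: v *m E; e + p *m E].
Proof.
move=> dL LH; have [u [w Luw]] := line_basis dL.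
have [a [v1 uE]] := frame_decomposition u.
have [b [v2 wE]] := frame_decomposition w.
wlog a0 : u w a b v1 v2 uE wE Luw / a != 0.
  move=> IH; have [a0|a0] := eqVneq a 0; last exact: (IH u w a b v1 v2).
  have [b0|b0] := eqVneq b 0; last first.
    apply: (IH w u b a v2 v1) => //.
    by rewrite (@perm_basis _ _ _ [:: u; w]) // (permEl (perm_catC [:: w] [:: u])).
  case/negP: LH; rewrite -(span_basis Luw); apply/span_subvP => z.
  by rewrite !inE uE wE a0 b0 !scale0r !add0r => /orP[] /eqP ->; rewrite mem_frame.
exists (v2 - (b / a) *: v1), (a^-1 *: v1).
have yE : e + a^-1 *: v1 *m E = a^-1 *: u.
  by rewrite uE scalerDr scalerA mulVf // scale1r -scalemxAl.
have xE : (v2 - (b / a) *: v1) *m E = w - (b / a) *: u.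
  rewrite wE uE mulmxBl -scalemxAl scalerDr scalerA divfK //.
  by rewrite opprD addrACA subrr add0r.
apply: (line_basisE Luw); rewrite xE yE.
  rewrite -[X in X \in _](_ : 0 *: (w - (b / a) *: u) + a *: (a^-1 *: u) = _) ?mem_pencil //.
  by rewrite scale0r add0r scalerA divff // scale1r.
rewrite -[X in X \in _](_ : 1 *: (w - (b / a) *: u) + b *: (a^-1 *: u) = _) ?mem_pencil //.
by rewrite scale1r scalerA subrK.
Qed.


(** The affine point may slide along the line. *)
Lemma basis_ext L v p s : basis_of L [:: v *m E; e + p *m E] ->
  basis_of L [:: v *m E; e + (p + s *: v) *m E].
Proof.
move=> Lb; apply: (line_basisE Lb).
  rewrite -[X in X \in _](_ : 1 *: (v *m E) + 0 *: (e + (p + s *: v) *m E) = _) ?mem_pencil //.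
  by rewrite scale1r scale0r addr0.
rewrite -[X in X \in _](_ : - s *: (v *m E) + 1 *: (e + (p + s *: v) *m E) = _) ?mem_pencil //.
by rewrite scale1r mulmxDl -scalemxAl scaleNr addrC !addrA addrK.
Qed.

End Frame.

Section Moment.
Variables (K : numClosedFieldType) (m : nat).
Let n := m.+3.
Variables (H : {vspace 'rV[K]_n.+1}) (q : 'M[K]_n.+1).
Variables (e : 'rV[K]_(1 + n)) (E : 'M[K]_(n, 1 + n)).
Hypothesis Eq : E *m q *m E^T = 1%:M.
Hypothesis HE : forall u, (u \in H) = (u <= E)%MS.
Hypothesis Pu : col_mx e E \in unitmx.
Hypothesis qs : q^T = q.
Let I := 'I_(n.+1 + m).
Variable X : I -> 'M[K]_n.+1.
Hypothesis Xq : forall i, quadrics_cutting H q (X i).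
Let b i := linear_part e E (X i).
Let c i := const_part e (X i).
Hypothesis bu : \det (moment_mx b) != 0.

Lemma moment_mx_inj (z : K) (w : 'rV[K]_n) :
  (forall i, z + dot (b (lshift m i)) w *+ 2 = 0) -> z = 0 /\ w = 0.
Proof.
move=> zw; have Mzw : moment_mx b *m col_mx z%:M w^T = 0.
  by apply/colP => i; rewrite mul_moment_mx zw mxE.
have Mu : moment_mx b \in unitmx by rewrite unitmxE unitfE.
have : col_mx z%:M w^T = 0 by rewrite -[LHS](mulKmx Mu) Mzw mulmx0.
rewrite -col_mx0 => /eq_col_mx [z0 w0]; split; last by apply: trmx_inj; rewrite w0 trmx0.
by move/(congr1 (fun A : 'M_1 => A 0 0)): z0; rewrite !mxE eqxx mulr1n.
Qed.

(** A line through a point of Q would satisfy b_i v + v p = 0 for all i, which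
    the invertibility of the system forbids. The affine point p can therefore be
    chosen orthogonal to v, and (v.v) p is then the moment of the line. *)
Lemma tangent_line_moment L : (\dim L = 2)%N -> ~~ (L <= H)%VS ->
    (forall i, tangent (X i) L) ->
  exists v p, [/\ basis_of L [:: v *m E; e + p *m E], dot v p = 0, dot v v != 0 &
    forall i, tangency_form b c v i =
      dot v v * dot p p + dot (b i) (dot v v *: p) *+ 2].
Proof.
move=> dL LH tL; have [v [p Lb]] := affine_line_basis HE Pu dL LH.
have four0 : (4%:R : K) != 0 by rewrite pnatr_eq0.
have disc r i : basis_of L [:: v *m E; e + r *m E] ->
    (dot (b i) v + dot v r) ^+ 2 = dot v v * (dot r r + dot (b i) r *+ 2 + c i).
  move=> Lr; have /eqP := tL i _ _ Lr.
  rewrite (line_disc_frame e Eq HE qs) // mulf_eq0 (negbTE four0) subr_eq0.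
  by move=> /eqP.
have v0 : v != 0.
  apply/eqP => v0; have := basis_free Lb.
  by rewrite free_cons v0 mul0mx mem0v.
have vv0 : dot v v != 0.
  apply/eqP => vv0; case/negP: v0; apply/eqP.
  have bv i : dot v p + dot (b (lshift m i)) (2%:R^-1 *: v) *+ 2 = 0.
    have /eqP := disc p (lshift m i) Lb; rewrite vv0 mul0r expf_eq0 /= => /eqP bvp.
    by rewrite dotZr -[RHS]bvp addrC; field.
  have [_ /eqP] := moment_mx_inj bv.
  by rewrite scaler_eq0 invr_eq0 pnatr_eq0 => /eqP.
pose s := - (dot v p / dot v v).
have Ls := basis_ext s Lb.
exists v, (p + s *: v); have vp0 : dot v (p + s *: v) = 0.
  by rewrite dotDr dotZr /s mulNr divfK // subrr.
split=> // i; have := disc _ i Ls; rewrite vp0 addr0 /tangency_form => ->.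
by rewrite dotZr; ring.
Qed.

Section OneLine.
Variables (v p : 'rV[K]_n).
Hypothesis vp0 : dot v p = 0.
Hypothesis vv0 : dot v v != 0.
Hypothesis vpX : forall i, tangency_form b c v i =
      dot v v * dot p p + dot (b i) (dot v v *: p) *+ 2.

(** With w = (v.v) p and z = (v.v)(p.p), the quartic w.w = (v.v) z is an identity
    and the cubic w.v vanishes because v.p does. *)
Lemma eliminant_tangent_line j : eliminant b c v j = 0.
Proof.
rewrite (@eliminantE _ _ _ _ _ (dot v v * dot p p) (dot v v *: p)) => [|i]; last exact: vpX.
case: j => [[k|]|].
- by rewrite vpX; ring.
- by rewrite dotZl dotC vp0 !mulr0.
- by rewrite !(dotZl, dotZr); ring.
Qed.

End OneLine.

(** Scaling v by t scales the forms and hence the moment by t^2, so that p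
    depends only on the point v at infinity. *)
Lemma affine_point_unique v p v' p' t : v' = t *: v ->
    dot v v != 0 -> dot v' v' != 0 ->
    (forall i, tangency_form b c v i =
      dot v v * dot p p + dot (b i) (dot v v *: p) *+ 2) ->
    (forall i, tangency_form b c v' i =
      dot v' v' * dot p' p' + dot (b i) (dot v' v' *: p') *+ 2) ->
  p' = p.
Proof.
move=> -> vv0 vv'0 vX vX'.
have [w wE] : exists w, w = dot v v *: p by exists (dot v v *: p).
have [w' w'E] : exists w, w = dot (t *: v) (t *: v) *: p' by exists (dot (t *: v) (t *: v) *: p').
rewrite -wE in vX; rewrite -w'E in vX'.
have [|_ /eqP] := @moment_mx_inj
   (dot (t *: v) (t *: v) * dot p' p' - t ^+ 2 * (dot v v * dot p p))
   (w' - t ^+ 2 *: w).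
  move=> i; rewrite -scaleN1r dotDr [dot _ (_ *: (_ *: w))]dotZr [dot _ (_ *: w)]dotZr.
  have -> : forall z' z x' x : K, z' - t ^+ 2 * z + (x' + -1 * (t ^+ 2 * x)) *+ 2 =
     (z' + x' *+ 2) - t ^+ 2 * (z + x *+ 2) by move=> *; ring.
  by rewrite -vX -vX' /tangency_form !(dotZl, dotZr); ring.
rewrite subr_eq0 wE w'E !(dotZl, dotZr) in vv'0 * => /eqP ww.
apply: (scalerI vv'0); rewrite ww scalerA; congr (_ *: _); ring.
Qed.

(** A line is determined by its point at infinity v, which is a common zero of
    the eliminants. *)
Lemma tangent_lines_le d (S : finType) (std : S -> 'X_{1..n})
    (L : 'I_d.+1 -> {vspace 'rV[K]_n.+1}) :
  row_full (macaulay_mx d std (eliminant_form b c)) ->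
  injective L -> (forall k, \dim (L k) = 2)%N -> (forall k, ~~ (L k <= H)%VS) ->
  (forall k i, tangent (X i) (L k)) -> (d < #|S|)%N.
Proof.
move=> full Linj dL LH tL.
have /boolp.choice [v /boolp.choice [p vp]] k := tangent_line_moment (dL k) (LH k) (tL k).
apply: (@macaulay_zeros _ _ _ _ (@degree m) std _ (eliminant_form b c) (fun k => v k 0)) => //.
- exact: eliminant_form_homog.
- move=> k j; have [_ vp0 _ vpX] := vp k.
  by rewrite meval_eliminant_form; exact: (eliminant_tangent_line vp0 vpX).
move=> k l kl; apply: boolp.contrapT => cross; case/negP: kl; apply/eqP/Linj.
have [Lk vpk vvk Xk] := vp k; have [Ll vpl vvl Xl] := vp l.
have [a va] : exists a, v k 0 a != 0.
  apply: boolp.contrapT => no; case/negP: vvk; apply/eqP; rewrite /dot big1 // => a _.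
  by have [->|va] := eqVneq (v k 0 a) 0; [rewrite mul0r | case: no; exists a].
have vE : v l = (v l 0 a / v k 0 a) *: v k.
  apply/rowP => i; rewrite mxE; apply: (mulIf va); rewrite mulrAC divfK //.
  apply/eqP; apply: boolp.contrapT => /negP ne; apply: cross; exists i, a.
  by [].
have pE := affine_point_unique vE vvk vvl Xk Xl.
rewrite -(span_basis Lk) -pE; apply/esym.
suff /span_basis <- : basis_of (L l) [:: v k *m E; e + p l *m E] by [].
apply: (line_basisE Ll); last by rewrite memv_span // !inE eqxx orbT.
by rewrite vE -scalemxAl memvZ // memv_span // !inE eqxx.
Qed.

End Moment.

(** * Tangent lines contained in the hyperplane *)

Section ChangeOfBasis.
Variables (K : fieldType) (n : nat).
Implicit Types (A : 'M[K]_n.+1) (u v : 'rV[K]_n.+1).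

Lemma line_disc_change A a b c d u v : A^T = A ->
  line_disc A (a *: u + b *: v) (c *: u + d *: v) =
  (a * d - b * c) ^+ 2 * line_disc A u v.
Proof.
move=> As; rewrite /line_disc /quad_form !polar_formE (polar_formC v u As); ring.
Qed.

Lemma pluecker_change a b c d u v ij :
  pluecker (a *: u + b *: v) (c *: u + d *: v) ij = (a * d - b * c) * pluecker u v ij.
Proof. by rewrite /pluecker !mxE; ring. Qed.

Lemma basis_change L u v x y : basis_of L [:: u; v] -> basis_of L [:: x; y] ->
  exists a b c d, x = a *: u + b *: v /\ y = c *: u + d *: v.
Proof.
move=> Luv Lxy; have Lx z : z \in [:: x; y] -> z \in <<[:: u; v]>>%VS.
  by move=> zxy; rewrite (span_basis Luv) (basis_mem Lxy).
have [a [b xE]] : exists a b, x = a *: u + b *: v by apply/pencilP/Lx; rewrite !inE eqxx.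
have [c [d yE]] : exists a b, y = a *: u + b *: v.
  by apply/pencilP/Lx; rewrite !inE eqxx orbT.
by exists a, b, c, d.
Qed.

Lemma tangent_basis A L u v : A^T = A -> basis_of L [:: u; v] ->
  line_disc A u v = 0 -> tangent A L.
Proof.
move=> As Luv uv0 x y Lxy; have [a [b [c [d [-> ->]]]]] := basis_change Luv Lxy.
by rewrite line_disc_change // uv0 mulr0.
Qed.

Lemma peval_homog (I : finType) k (g : {mpoly K[#|I|]}) t (x y : I -> K) :
  g \is k.-homog -> (forall i, y i = t * x i) -> peval g y = t ^+ k * peval g x.
Proof.
move=> gh yE; rewrite /peval !mevalE mulr_sumr big_seq [RHS]big_seq.
apply: eq_bigr => M Mg; rewrite mulrCA; congr (_ * _).
rewrite -(dhomog_mf gh Mg) /= mdegE -prodrXr -big_split /=.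
by apply: eq_bigr => i _; rewrite yE exprMn.
Qed.

Lemma pluecker_vanish_basis (g : {mpoly K[#|{: 'I_n.+1 * 'I_n.+1}|]}) k L u v :
  g \is k.-homog -> basis_of L [:: u; v] -> peval g (pluecker u v) = 0 ->
  pluecker_vanish g L.
Proof.
move=> gh Luv uv0 x y Lxy; have [a [b [c [d [-> ->]]]]] := basis_change Luv Lxy.
by rewrite (peval_homog gh (pluecker_change a b c d u v)) uv0 mulr0.
Qed.

End ChangeOfBasis.

Lemma horner_meval (K : fieldType) N (g : {mpoly K[N]}) (v : 'I_N -> {poly K}) s :
  ((map_mpoly polyC g).@[v]).[s] = g.@[fun i => (v i).[s]].
Proof.
rewrite /map_mpoly /mmap raddf_sum horner_sum mevalE; apply: eq_bigr => M _ /=.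
rewrite mevalM mevalC hornerM hornerC /mmap1 rmorph_prod horner_prod.
congr (_ * _); apply: eq_bigr => i _.
by rewrite rmorphXn /= mevalXU horner_exp.
Qed.

Lemma free_pair (K : fieldType) (V : vectType K) (x y : V) :
  (forall a b, a *: x + b *: y = 0 -> a = 0 /\ b = 0) -> free [:: x; y].
Proof.
move=> xy; apply/(@freeP _ _ _ [tuple x; y]) => k.
rewrite !big_ord_recl big_ord0 /= addr0 => /xy [k0 k1] i.
by case: (unliftP ord0 i) => [j|] -> //; rewrite ord1.
Qed.

Section Moving.
Variables (K : numClosedFieldType) (n k : nat).
Variables (H : {vspace 'rV[K]_n.+1}) (q : 'M[K]_n.+1).
Hypotheses (qs : q^T = q) (qH : nondegenerate_on H q).
Variable X : 'I_k -> 'M[K]_n.+1.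
Hypothesis Xq : forall i, quadrics_cutting H q (X i).

(** A non-constant polynomial family of tangent lines through L meets every
    neighbourhood of L outside L: a polynomial in the parameter which does not
    vanish at 0 does not vanish at some other value. *)
Lemma moving_line_not_isolated L p w r a b c :
    basis_of L [:: p; w] -> p \in H -> w \in H -> r \in H -> r \notin L -> c != 0 ->
    (forall s, let P := p + (s * a) *: w + (s ^+ 2 * b) *: r in
               let W := w + (s * c) *: r in
      quad_form q P = 0 /\ polar_form q P W = 0) ->
  ~ isolated_in (common_tangents X) L.
Proof.
move=> Lpw pH wH rH rL c0 PW [O [S Sh ->]] OL.
pose P s := p + (s * a) *: w + (s ^+ 2 * b) *: r.
pose W s := w + (s * c) *: r.
have pwr x y z : x *: p + y *: w + z *: r = 0 -> [/\ x = 0, y = 0 & z = 0].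
  move=> xyz; have z0 : z = 0.
    apply/eqP; apply: contraNT rL => z0.
    have -> : r = (- (x / z)) *: p + (- (y / z)) *: w.
      apply: (scalerI z0); rewrite scalerDr !scalerA !mulrN !mulrA.
      rewrite ![z * _]mulrC !mulfK // !scaleNr -opprD.
      by apply/eqP; rewrite -addr_eq0 addrC xyz.
    by rewrite -(span_basis Lpw) mem_pencil.
  move: xyz; rewrite z0 scale0r addr0 => xy.
  have /freeP/(_ (fun i : 'I_2 => [:: x; y]`_i)) := (basis_free Lpw : free [tuple p; w]).
  rewrite !big_ord_recl big_ord0 /= addr0 => /(_ xy) xy0.
  by split=> //; [have := xy0 0 | have := xy0 1].
have Lfree s : free [:: P s; W s].
  apply: free_pair => x y xy.
  have [|x0 yE _] := @pwr x (x * (s * a) + y) (x * (s ^+ 2 * b) + y * (s * c)).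
    rewrite -[RHS]xy /P /W !scalerDr !scalerA !scalerDl.
    by rewrite !addrA; congr (_ + _); rewrite addrAC.
  by move: yE; rewrite x0 mul0r add0r => ->.
have [g Sg gL] : exists2 g, S g & ~ pluecker_vanish g L.
  have : ([set L]%classic : set _) L by [].
  by rewrite -OL => -[[]].
have [dg gh] := Sh g Sg.
have gpw : peval g (pluecker p w) != 0.
  by apply/eqP => gpw; apply/gL/(pluecker_vanish_basis gh Lpw).
pose Pp i : {poly K} := (p 0 i)%:P + 'X * a%:P * (w 0 i)%:P + 'X ^+ 2 * b%:P * (r 0 i)%:P.
pose Wp i : {poly K} := (w 0 i)%:P + 'X * c%:P * (r 0 i)%:P.
pose f : {poly K} := (map_mpoly polyC g).@[fun l =>
  let ij := enum_val l in Pp ij.1 * Wp ij.2 - Pp ij.2 * Wp ij.1].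
have fE s : f.[s] = peval g (pluecker (P s) (W s)).
  rewrite /f horner_meval; apply: meval_eq => l /=.
  by rewrite /pluecker /P /W !mxE /Pp /Wp !hornerE.
have f0 : 'X * f != 0.
  apply: mulf_neq0; first by rewrite polyX_eq0.
  apply: contraNneq gpw => f0; have := fE 0.
  by rewrite f0 horner0 /P /W expr0n !mul0r !scale0r !addr0 => <-.
have /closed_nonrootP [s] := f0.
rewrite rootM rootX negb_or => /andP[s0]; rewrite rootE fE => gs.
pose L' := <<[:: P s; W s]>>%VS.
have L'b : basis_of L' [:: P s; W s] by rewrite /basis_of eqxx Lfree.
have L'd : (\dim L' = 2)%N by have /eqP := Lfree s.
have PH : P s \in H by rewrite !memvD ?memvZ.
have WH : W s \in H by rewrite !memvD ?memvZ.
have L'L : L' = L.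
  suff : ([set L]%classic : set _) L' by [].
  rewrite -OL; split; first split=> //.
    by exists g => // gL'; have := gL' _ _ L'b; apply/eqP.
  split=> // i; have [Xs _] := Xq i; apply: (tangent_basis Xs L'b).
  have [PP0 PW0] := PW s.
  rewrite /line_disc /quad_form !(polar_form_cutting_in qs (Xq i)) //.
  rewrite PW0 [polar_form q (P s) _]PP0; ring.
case/negP: rL; have -> : r = (s * c)^-1 *: W s - (s * c)^-1 *: w.
  by rewrite -scalerBr /W addrC addKr scalerA mulVf ?scale1r ?mulf_neq0.
rewrite memvB ?memvZ //; last by rewrite -(span_basis Lpw) memv_span // !inE eqxx orbT.
by rewrite -L'L memv_span // !inE eqxx orbT.
Qed.

(** Let p be in the radical of q on L, and w complete it to a basis of L. If
    some r in H orthogonal to p lies outside L, the line turns around p towards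
    r. Otherwise L is all of the orthogonal of p in H, an isotropic vector r
    completes p and w to a basis of H, and L moves along the tangent lines of
    the conic parametrized by p + s w - (s^2 q(w) / 2) r. *)
Lemma tangent_line_in_hyperplane_not_isolated L :
  (0 < k)%N -> (L <= H)%VS -> ~ isolated_in (common_tangents X) L.
Proof.
move=> k0 LH iL; have [[dL tL]] : common_tangents X L.
  have [O _ OL] := iL; have : ([set L]%classic : set _) L by [].
  by rewrite -OL => -[].
have [u [v Luv]] := line_basis dL.
have LinH x y : basis_of L [:: x; y] -> x \in H /\ y \in H.
  move=> Lxy; split; apply: (subvP LH); rewrite (basis_mem Lxy) // !inE eqxx ?orbT //.
have polC x y : polar_form q x y = polar_form q y x by exact: polar_formC.
have two0 : (2%:R : K) != 0 by rewrite pnatr_eq0.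
(* The discriminant of q on L vanishes, so q on L has a radical. *)
have [p [w [Lpw qpp qpw]]] : exists p w,
    [/\ basis_of L [:: p; w], polar_form q p p = 0 & polar_form q p w = 0].
  have [uH vH] := LinH _ _ Luv.
  have := tL (Ordinal k0) u v Luv.
  rewrite /line_disc /quad_form !(polar_form_cutting_in qs (Xq _)) // => disc.
  have {}disc : polar_form q u v ^+ 2 = polar_form q u u * polar_form q v v.
    apply: (mulfI (_ : 4%:R != 0)); first by rewrite pnatr_eq0.
    by apply/eqP; rewrite -subr_eq0 -[X in _ == X]disc; apply/eqP; ring.
  have [uu|uu] := eqVneq (polar_form q u u) 0.
    exists u, v; split=> //; apply/eqP.
    by rewrite -[_ == 0](expf_eq0 _ 2) disc uu mul0r.
  exists (polar_form q u v *: u - polar_form q u u *: v), u; split.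
  - apply: (line_basisE Luv); first by rewrite memv_span // !inE eqxx orbT.
    have vE : v = (- (polar_form q u u)^-1) *: (polar_form q u v *: u - polar_form q u u *: v)
                  + (polar_form q u v / polar_form q u u) *: u.
      rewrite scalerBr !scalerA !mulNr mulVf // !scaleNr opprK scale1r.
      by rewrite addrAC [_^-1 * _]mulrC addNr add0r.
    by rewrite {1}vE mem_pencil.
  - rewrite -!scaleN1r !polar_formE (polC v u).
    have -> : polar_form q v v = polar_form q u v ^+ 2 / polar_form q u u.
      by rewrite disc mulrAC divff // mul1r.
    by field.
  - by rewrite -!scaleN1r !polar_formE (polC v u); ring.
have [pH wH] := LinH _ _ Lpw.
have [[r [rH pr rL]]|no] := boolp.pselect
    (exists r, [/\ r \in H, polar_form q p r = 0 & r \notin L]).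
  apply: (@moving_line_not_isolated L p w r 0 0 1) => //; first exact: oner_neq0.
  move=> s /=; rewrite !mulr0 !scale0r !addr0; split=> //.
  by rewrite !polar_formE qpw pr mulr0 addr0.
have pL x : x \in H -> polar_form q p x = 0 -> x \in L.
  by move=> xH px; apply: boolp.contrapT => /negP xL; apply: no; exists x.
have pw0 := basis_free Lpw.
have p0 : p != 0.
  by apply/eqP => p0; move: pw0; rewrite free_cons p0 mem0v.
have [r1 r1H pr1] : exists2 r, r \in H & polar_form q p r = 1.
  have [r rH pr] : exists2 r, r \in H & polar_form q p r != 0.
    apply: boolp.contrapT => none; move/eqP: p0; apply; apply: qH => // x xH.
    by apply/eqP; apply: boolp.contrapT => /negP px; apply: none; exists x.
  exists ((polar_form q p r)^-1 *: r); first by rewrite memvZ.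
  by rewrite polar_formZr mulVf.
(* If q(w) = 0, a combination of w and p is orthogonal to L and r1, hence to H. *)
have ww : polar_form q w w != 0.
  apply/eqP => ww; pose w' := w - polar_form q w r1 *: p.
  have : w' = 0.
    apply: qH => [|x xH]; first by rewrite memvB ?memvZ.
    have : x - polar_form q p x *: r1 \in L.
      apply: pL; first by rewrite memvB ?memvZ.
      by rewrite -scaleN1r !polar_formE pr1; ring.
    rewrite -(span_basis Lpw) => /pencilP [a [b xE]].
    have -> : x = a *: p + b *: w + polar_form q p x *: r1 by rewrite -xE subrK.
    rewrite /w' -scaleN1r !polar_formE (polC w p) qpw qpp ww pr1; ring.
  move=> /eqP; rewrite subr_eq0 => /eqP wE.
  move: pw0; rewrite (@perm_free _ _ _ [:: w; p]) ?(permEl (perm_catC [:: p] [:: w])) //.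
  by rewrite free_cons wE memvZ // memv_span // inE eqxx.
(* Correct r1 by w and p to have w.r = 0 and q(r) = 0, keeping p.r = 1. *)
pose r2 := r1 - (polar_form q w r1 / polar_form q w w) *: w.
have r2H : r2 \in H by rewrite memvB ?memvZ.
have pr2 : polar_form q p r2 = 1 by rewrite /r2 -scaleN1r !polar_formE pr1 qpw; ring.
have wr2 : polar_form q w r2 = 0 by rewrite /r2 -scaleN1r !polar_formE; field.
clearbody r2.
pose r := r2 - (polar_form q r2 r2 / 2%:R) *: p.
have rH : r \in H by rewrite memvB ?memvZ.
have pr : polar_form q p r = 1 by rewrite /r -scaleN1r !polar_formE pr2 qpp; ring.
have wr : polar_form q w r = 0.
  by rewrite /r -scaleN1r !polar_formE wr2 (polC w p) qpw; ring.
have rr : polar_form q r r = 0.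
  by rewrite /r -scaleN1r !polar_formE (polC r2 p) pr2 qpp; field.
clearbody r.
have rL : r \notin L.
  apply/negP; rewrite -(span_basis Lpw) => /pencilP [a [b rE]].
  move/eqP: pr; rewrite rE !polar_formE qpp qpw !mulr0 addr0 eq_sym.
  by rewrite oner_eq0.
apply: (@moving_line_not_isolated L p w r 1 (- (polar_form q w w / 2%:R))
          (- polar_form q w w)) => //; first by rewrite oppr_eq0.
move=> s /=; rewrite /quad_form !polar_formE.
rewrite (polC w p) (polC r p) (polC r w) qpp qpw pr wr rr.
by split; field.
Qed.

End Moving.

(** * The bound *)

Local Open Scope classical_set_scope.
Local Open Scope card_scope.

Lemma card_le_ordinal (T : Type) (A : set T) d :
  (forall f : 'I_d.+1 -> T, injective f -> exists k, ~ A (f k)) -> A #<= `I_d.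
Proof.
move=> no; suff large : ~ (`I_d.+1 #<= A).
  have [fA|/infiniteP natA] := boolp.pselect (finite_set A); last first.
    by case: large; apply: card_le_trans natA; exact: subset_card_le.
  have [k kA] := (finite_setP A).1 fA.
  have [kd|dk] := leqP k d.
    by rewrite (card_le_eql kA) card_le_II.
  by case: large; rewrite (card_le_eqr kA) card_le_II.
move=> /card_leP [f].
have mem (k : 'I_d.+1) : (k : nat) \in `I_d.+1 by rewrite inE /=.
have [|k] := no (fun k => val (f (SigSub (mem k)))).
  move=> k l /val_inj /(inj (mem_set I) (mem_set I)) /(congr1 val) /= kl.
  exact: val_inj.
by apply; exact: set_valP.
Qed.

Section QuadricWithParts.
Variables (K : numClosedFieldType) (n : nat) (e : 'rV[K]_(1 + n)) (E : 'M[K]_(n, 1 + n)).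
Hypothesis Pu : col_mx e E \in unitmx.

Definition quadric_of_parts (b : 'rV[K]_n) (c : K) : 'M[K]_n.+1 :=
  invmx (col_mx e E) *m block_mx c%:M b b^T 1%:M *m (invmx (col_mx e E))^T.

Lemma quadric_of_partsE b c (X := quadric_of_parts b c) :
  [/\ X^T = X, E *m X *m E^T = 1%:M, linear_part e E X = b & const_part e X = c].
Proof.
have Xs : X^T = X.
  by rewrite /X /quadric_of_parts !trmx_mul trmxK mulmxA tr_block_mx !trmxK !tr_scalar_mx.
have : col_mx e E *m X *m (col_mx e E)^T = block_mx c%:M b b^T 1%:M.
  rewrite /X /quadric_of_parts !mulmxA mulmxV // mul1mx -mulmxA -trmx_mul.
  by rewrite mulmxV // trmx1 mulmx1.
rewrite mul_col_mx tr_col_mx mul_col_row => /eq_block_mx [ec eb _ E1]; split=> //.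
by rewrite /const_part /quad_form /polar_form ec mxE eqxx mulr1n.
Qed.

End QuadricWithParts.

Section Bound.
Variables (K : numClosedFieldType) (m : nat).
Let n := m.+3.
Let k := (2 * n - 2)%N.
Variables (H : {vspace 'rV[K]_n.+1}) (q : 'M[K]_n.+1).
Hypotheses (dH : \dim H = n) (qs : q^T = q) (qH : nondegenerate_on H q).

Let Z : set ('I_k -> 'M[K]_n.+1) := [set X | forall i, quadrics_cutting H q (X i)].
Let N := #|{: 'I_k * ('I_n.+1 * 'I_n.+1)}|.
Let coord (X : 'I_k -> 'M[K]_n.+1) : 'I_N -> K := fun l => tuple_coord X (enum_val l).
Let d := (3 * 2 ^ (n - 1))%N.

(** The minor given by the special configuration, as a polynomial in the entries
    of the quadrics, controls all tuples where it does not vanish. *)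
Lemma generic_bound : exists p : {mpoly K[N]},
  (exists2 X, Z X & p.@[coord X] != 0) /\
  forall X, Z X -> p.@[coord X] != 0 -> isolated_in (common_tangents X) #<= `I_d.
Proof.
have [e [E [Eq HE Pu]]] := orthonormal_frame qs qH dH.
have kE : (n.+1 + m)%N = k by rewrite /k /n; lia.
pose ix : 'I_(n.+1 + m) -> 'I_k := cast_ord kE.
pose C r s (A : 'M[K]_(r, s)) : 'M[{mpoly K[N]}]_(r, s) := map_mx (@mpolyC N K) A.
pose G i : 'M[{mpoly K[N]}]_n.+1 := \matrix_(a, b) 'X_(enum_rank (i, (a, b))).
pose b i := C _ _ e *m G (ix i) *m (C _ _ E)^T.
pose c i := (C _ _ e *m G (ix i) *m (C _ _ e)^T) 0 0.
have CE x r s (A : 'M[K]_(r, s)) : map_mx (meval x) (C _ _ A) = A.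
  by apply/matrixP => a a'; rewrite !mxE mevalC.
have GE X i : map_mx (meval (coord X)) (G i) = X i.
  by apply/matrixP => a a'; rewrite !mxE mevalXU /coord enum_rankK.
have bE X i : map_mx (meval (coord X)) (b i) = linear_part e E (X (ix i)).
  by rewrite !map_mxM map_trmx !CE GE.
have cE X i : (c i).@[coord X] = const_part e (X (ix i)).
  transitivity (map_mx (meval (coord X)) (C _ _ e *m G (ix i) *m (C _ _ e)^T) 0 0).
    by rewrite [RHS]mxE.
  by rewrite !map_mxM map_trmx !CE GE.
pose X0 j := quadric_of_parts e E (special_linear K (cast_ord (esym kE) j))
                                  (special_const K (cast_ord (esym kE) j)).
have ZX0 : Z X0.
  move=> j; rewrite /X0; set b0 := special_linear _ _; set c0 := special_const _ _.
  have [Xs XE _ _] := quadric_of_partsE Pu b0 c0; split=> // u.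
  rewrite HE => /submxP [v ->].
  by rewrite /quad_form (polar_form_frame v v XE) (polar_form_frame v v Eq).
have [|i|p p0 hp] := @generic_macaulay_full K m N d b c (coord X0).
- move=> i; rewrite bE /X0 cast_ordK.
  by have [] := quadric_of_partsE Pu (special_linear K i) (special_const K i).
- rewrite cE /X0 cast_ordK.
  by have [] := quadric_of_partsE Pu (special_linear K i) (special_const K i).
exists p; split; first by exists X0.
move=> X ZX /hp [det0 full]; apply: card_le_ordinal => L Linj.
apply: boolp.contrapT => no.
have iL l : isolated_in (common_tangents X) (L l).
  by apply: boolp.contrapT => il; apply: no; exists l.
have tL l : common_tangents X (L l).
  have [O _ OL] := iL l; have : [set L l] (L l) by [].
  by rewrite -OL => -[].
have LH l : ~~ (L l <= H)%VS.
  apply/negP => lH.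
  by apply: (tangent_line_in_hyperplane_not_isolated qs qH ZX _ lH (iL l)).
suff : (d < #|{: standard_type m}|)%N by rewrite card_standard_type ltnn.
have bX : (fun i => map_mx (meval (coord X)) (b i)) = (fun i => linear_part e E (X (ix i))).
  by apply: boolp.funext => i; exact: bE.
have cX : (fun i => (c i).@[coord X]) = (fun i => const_part e (X (ix i))).
  by apply: boolp.funext => i; exact: cE.
rewrite bX in det0 full; rewrite cX in full.
apply: (tangent_lines_le Eq HE Pu qs (fun i => ZX (ix i)) det0 full Linj _ LH).
  by move=> l; case: (tL l).
by move=> l i; case: (tL l) => _; apply.
Qed.

End Bound.

Local Open Scope complex_scope.
Unset Implicit Arguments.

Theorem theorem11 (R : realType) (n : nat)
    (H : {vspace 'rV[R[i]]_n.+1}) (q : 'M[R[i]]_n.+1) :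
  (3 <= n)%N -> \dim H = n -> q^T = q -> nondegenerate_on H q ->
  exists U : set ('I_(2 * n - 2) -> 'M[R[i]]_n.+1),
    [/\ zariski_open_in (@tuple_coord _ n (2 * n - 2))
          [set X | forall i, quadrics_cutting H q (X i)] U,
        U !=set0 &
        forall X, U X ->
          isolated_in (common_tangents X) #<= `I_(3 * 2 ^ (n - 1))].
Proof.
case: n H q => [|[|[|m]]] // H q _ dH qs qH.
have [p [[X0 ZX0 pX0] hp]] := generic_bound dH qs qH.
exists [set X | (forall i, quadrics_cutting H q (X i)) /\
  exists2 r, [set p] r & peval r (tuple_coord X) != 0]; split.
- by exists [set p].
- by exists X0; split=> //; exists p.
- by move=> X [ZX [r -> pX]]; exact: hp.
Qed.
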